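(* Let $M\ge 2$ and $K,L\ge 2$ be integers and let $\Lambda$ be the $K\times L$ square lattice, with either periodic boundary conditions (in which case assume $K+L\ge 6$) or open boundary conditions. Let $(\mathcal X,H,q)$ be the energy landscape of the Metropolis dynamics of the Widom-Rowlinson model with $M$ types of particles on $\Lambda$, and let $\mathcal X^s$ be its set of stable configurations. Define $$\Gamma(\Lambda):=\begin{cases}2K & \text{if }\Lambda\text{ has periodic boundary conditions, } K=L,\ K+L\ge 6,\\ \min\{2K,2L\}+1 & \text{if }\Lambda\text{ has periodic boundary conditions, } K\ne L,\ K+L\ge 6,\\ \min\{K,L\}+1 & \text{if }\Lambda\text{ has open boundary conditions.}\end{cases}$$ Then (i) $\Phi(\mathbf s,\mathbf s')-H(\mathbf s)=\Gamma(\Lambda)$ for every $\mathbf s,\mathbf s'\in\mathcal X^s$ with $\mathbf s\ne\mathbf s'$; and (ii) $\Phi(\sigma,\mathcal X^s)-H(\sigma)<\Gamma(\Lambda)$ for every $\sigma\in\mathcal X\setminus\mathcal X^s$.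
   Context: Lattice: the $K\times L$ square lattice $\Lambda$ has vertex (site) set $\{(j,i): 0\le j\le L-1,\ 0\le i\le K-1\}$ ($j$ = column index, $i$ = row index), $N=KL$ sites. With open boundary conditions, two sites are adjacent iff $|j-j'|+|i-i'|=1$. With periodic boundary conditions, two distinct sites are adjacent iff either $i=i'$ and $j'\equiv j\pm1 \pmod L$, or $j=j'$ and $i'\equiv i\pm1\pmod K$. Configurations: a Widom-Rowlinson configuration with $M$ particle types is a $\sigma\in\{0,1,\dots,M\}^{\Lambda}$ such that for every edge $(v,w)$ of $\Lambda$, $\sigma(v)\sigma(w)=0$ or $\sigma(v)=\sigma(w)$ ($0$ = empty, $m$ = particle of type $m$). $\mathcal X$ is the set of these configurations. The energy is $H(\sigma)=-\sum_{v}\mathbf 1_{\{\sigma(v)\neq0\}}$. The set of stable configurations $\mathcal X^s$ is the set of global minimizers of $H$ on $\mathcal X$; it equals $\{\mathbf s^{(1)},\dots,\mathbf s^{(M)}\}$ with $\mathbf s^{(m)}(v)=m$ for all $v$. Connectivity: for $\sigma\ne\sigma'$ in $\mathcal X$, $q(\sigma,\sigma')=\frac1{MN}$ if $\sigma,\sigma'$ differ at exactly one site $v$ and one of $\sigma(v),\sigma'(v)$ is $0$ (a single particle is added or removed), and $q(\sigma,\sigma')=0$ otherwise; $q(\sigma,\sigma)=1-\sum_{\eta\ne\sigma}q(\sigma,\eta)$. Paths and heights: a path $\omega:\sigma\to\sigma'$ is a finite sequence $\omega_1=\sigma,\dots,\omega_n=\sigma'$ in $\mathcal X$ with $q(\omega_i,\omega_{i+1})>0$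 for all $i$. Its height is $\Phi_\omega=\max_iH(\omega_i)$. The communication height is $\Phi(\sigma,\sigma')=\min_{\omega:\sigma\to\sigma'}\Phi_\omega$, and $\Phi(A,B)=\min_{\sigma\in A,\sigma'\in B}\Phi(\sigma,\sigma')$ for disjoint non-empty $A,B\subset\mathcal X$ (with $\Phi(\sigma,B)=\Phi(\{\sigma\},B)$). *)

(* Defs.v *)
From mathcomp Require Import all_boot all_order all_algebra.
From mathcomp Require Import boolp classical_sets.

Set Implicit Arguments.
Unset Strict Implicit.
Unset Printing Implicit Defensive.

Import Order.TTheory GRing.Theory Num.Theory.
Local Open Scope ring_scope.

(* The default value 0 is returned only when [A] has no minimum. *)
Definition int_min (A : classical_sets.set int) : int :=
  xget 0 (classical_sets.setI A (lbound A)).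

Variant boundary := Periodic | Open.

(* A site is a pair (column j, row i). *)
Definition site (K L : nat) : finType := ('I_L * 'I_K)%type.

Definition cyc_adj (n a b : nat) : bool :=
  ((b == a + 1 %[mod n]) || (b + 1 == a %[mod n]))%N.

(* In the open case the absolute differences are taken in [int], with values
   in [nat]. *)
Definition adjacent (bc : boundary) (K L : nat) (v w : site K L) : bool :=
  match bc with
  | Open => (`|v.1%:Z - w.1%:Z| + `|v.2%:Z - w.2%:Z| == 1)%N
  | Periodic =>
      (v != w) &&
      ((v.2 == w.2) && cyc_adj L v.1 w.1 || (v.1 == w.1) && cyc_adj K v.2 w.2)
  end.

Definition admissible (bc : boundary) (K L M : nat)
    (sigma : {ffun site K L -> 'I_M.+1}) : bool :=
  [forall v, forall w, adjacent bc v w ==>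
     (sigma v * sigma w == 0)%N || (sigma v == sigma w)].

Definition config (bc : boundary) (K L M : nat) : finType :=
  {sigma : {ffun site K L -> 'I_M.+1} | admissible bc sigma}.

Section Landscape.
Variables (bc : boundary) (K L M : nat).
Local Notation X := (config bc K L M).
Implicit Types (s t : X) (A B : {set X}).

Definition energy s : int := - \sum_(v : site K L) (val s v != ord0)%:Z.

Definition stable : {set X} := [set s | [forall t, energy s <= energy t]].

Definition single_particle_move s t : bool :=
  [exists v, [&& val s v != val t v,
                 (val s v == ord0) || (val t v == ord0)
               & [forall w, (w != v) ==> (val s w == val t w)]]].

Definition conn_off s t : rat :=
  if single_particle_move s t then (M * (K * L))%:R^-1 else 0.

Definition conn s t : rat :=
  if s == t then 1 - \sum_(u | u != s) conn_off s u else conn_off s t.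

(* The path omega_1, ..., omega_n is represented by its first element [s] and
   the list [p] of the remaining ones. *)
Definition is_path s t (p : seq X) : bool :=
  path (fun u v => 0 < conn u v) s p && (last s p == t).

Definition height s (p : seq X) : int :=
  \big[Order.max/energy s]_(u <- p) energy u.

Definition path_heights s t : classical_sets.set int :=
  fun h => exists2 p, is_path s t p & h = height s p.

Definition comm_height s t : int := int_min (path_heights s t).

Definition set_comm_heights A B : classical_sets.set int :=
  fun h => exists s, exists t, [/\ s \in A, t \in B & h = comm_height s t].

Definition comm_height_set A B : int := int_min (set_comm_heights A B).

End Landscape.

Arguments stable bc K L M : clear implicits.

(* For periodic boundary conditions this is only meaningful if K + L >= 6. *)
Definition Gamma (bc : boundary) (K L : nat) : nat :=
  match bc with
  | Periodic =>
      if K == L then (2 * K)%N else (minn (2 * K) (2 * L)).+1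
  | Open => (minn K L).+1
  end.

(* The minima defining the communication heights are attained, so that the
   default value in [int_min] is never used. *)

Lemma int_minP (A : classical_sets.set int) (m : int) :
  (exists h, A h) -> lbound A m ->
  A (int_min A) /\ lbound A (int_min A).
Proof.
move=> [h Ah] lm; apply: (@xgetPex _ 0 (classical_sets.setI A (lbound A))).
have: exists n : nat, A (m + n%:Z).
  exists `|h - m|%N; rewrite gez0_abs ?subr_ge0; last exact: lm.
  by rewrite (addrC m) subrK.
move=> [n]; elim/ltn_ind: n => n IHn An.
have [[k ltkn Ak]|nok] := pselect (exists2 k, (k < n)%N & A (m + k%:Z)).
  exact: IHn Ak.
exists (m + n%:Z); split=> // x Ax; rewrite leNgt; apply/negP => ltxn.
apply: nok; have lemx := lm _ Ax; exists `|x - m|%N; last first.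
  by rewrite gez0_abs ?subr_ge0 // (addrC m) subrK.
by rewrite -ltz_nat gez0_abs ?subr_ge0 // ltrBlDl.
Qed.

Section Attained.
Variables (bc : boundary) (K L M : nat).
Local Notation X := (config bc K L M).
Implicit Types (s t : X).

Lemma move_sym s t : single_particle_move s t = single_particle_move t s.
Proof.
apply/existsP/existsP => -[v /and3P[a b /forallP c]]; exists v;
  rewrite eq_sym a orbC b /=; apply/forallP => w; apply/implyP => wv;
  by rewrite eq_sym; apply: (implyP (c w)).
Qed.

Lemma conn_gt0 s t : single_particle_move s t -> 0 < conn s t.
Proof.
move=> mst; have [v /and3P[dv zv _]] := existsP mst.
rewrite /conn; case: eqP => [est|_]; first by rewrite est eqxx in dv.
rewrite /conn_off mst invr_gt0 ltr0n !muln_gt0.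
rewrite (leq_trans _ (ltn_ord v.1)) // (leq_trans _ (ltn_ord v.2)) // !andbT.
case: (posnP M) => // M0; case/eqP: dv; apply: val_inj => /=.
have o0 (i : 'I_M.+1) : i = 0 :> nat.
  by have := ltn_ord i; rewrite [X in (_ < X.+1)%N]M0 ltnS leqn0 => /eqP.
by rewrite !o0.
Qed.

Lemma connect_sym_move : connect_sym (@single_particle_move bc K L M).
Proof. exact/sym_connect_sym/move_sym. Qed.

Definition remove (f : {ffun site K L -> 'I_M.+1}) (v : site K L) :
  {ffun site K L -> 'I_M.+1} := [ffun w => if w == v then ord0 else f w].

Lemma remove_adm (s : X) v : admissible bc (remove (val s) v).
Proof.
apply/forallP => a; apply/forallP => b; apply/implyP => adj; rewrite !ffunE.
case: (a == v); first by rewrite mul0n.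
case: (b == v); first by rewrite [X in (X == 0)%N]muln0.
by have /forallP/(_ a)/forallP/(_ b)/implyP := valP s; apply.
Qed.

Lemma empty_adm : admissible bc ([ffun=> ord0] : {ffun site K L -> 'I_M.+1}).
Proof.
by apply/forallP => a; apply/forallP => b; rewrite !ffunE eqxx orbT implybT.
Qed.

Definition empty_config : X :=
  exist (fun f => admissible bc f) _ empty_adm.

Definition remove_config s v : X :=
  exist (fun f => admissible bc f) _ (remove_adm s v).

Lemma connect_empty s :
  connect (@single_particle_move bc K L M) s empty_config.
Proof.
have [n] := ubnP #|[set v | val s v != ord0]|; elim: n s => // n IHn s lesn.
have [v /= nzv|z] := pickP [pred v | val s v != ord0]; last first.
  rewrite (_ : s = empty_config) //; apply/val_inj/ffunP => v /=.
  by rewrite ffunE; have /= /negbFE/eqP := z v.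
apply: connect_trans (IHn (remove_config s v) _); last first.
  rewrite ltnS in lesn; apply: leq_trans lesn; apply: proper_card.
  apply/properP; split; last first.
    by exists v; rewrite !inE //= ffunE eqxx.
  by apply/fintype.subsetP => w; rewrite !inE /= ffunE; case: (w == v); rewrite ?eqxx.
apply: connect1; apply/existsP; exists v; rewrite /= ffunE eqxx orbT nzv /=.
by apply/forallP => w; apply/implyP => /negPf wv; rewrite ffunE wv.
Qed.

Lemma path_heights_neq0 s t : exists h, path_heights s t h.
Proof.
have: connect (@single_particle_move bc K L M) s t.
  by apply: connect_trans (connect_empty s) _;
     rewrite connect_sym_move connect_empty.
case/connectP => p pp ->; exists (height s p), p => //.
rewrite /is_path eqxx andbT; apply: sub_path pp; exact: conn_gt0.
Qed.

Lemma path_heights_lb s t : lbound (path_heights s t) (energy s).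
Proof.
move=> _ [p _ ->]; rewrite /height; elim: p => [|u p IHp]; first by rewrite big_nil.
by rewrite big_cons le_max IHp orbT.
Qed.

Lemma comm_heightP s t :
  path_heights s t (comm_height s t) /\
  lbound (path_heights s t) (comm_height s t).
Proof. exact: int_minP (path_heights_neq0 s t) (@path_heights_lb s t). Qed.

Lemma comm_height_setP (A B : {set X}) s t : s \in A -> t \in B ->
  set_comm_heights A B (comm_height_set A B) /\
  lbound (set_comm_heights A B) (comm_height_set A B).
Proof.
move=> sA tB; apply: (@int_minP _ (- (#|{: site K L}|)%:Z)).
  by exists (comm_height s t), s, t.
move=> _ [a [b [_ _ ->]]]; have [[p pp ->] _] := comm_heightP a b.
apply: le_trans (path_heights_lb (ex_intro2 _ _ p pp erefl)).
rewrite /energy lerN2 -(big_morph _ PoszD (erefl _)) lez_nat -sum1_card.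
by apply: leq_sum => v _; case: (_ != _).
Qed.

End Attained.

(* Main.v *)
Require Import Defs.
From mathcomp Require Import all_boot all_order all_algebra.
From mathcomp Require Import zify.

(** Empty sites separate particles of different types, and the energy is the
    number of empty sites minus [K * L]. The statement is thus about the
    largest number of vacancies that a passage between two monochromatic
    states must create, a vertex-isoperimetric question.

    Lower bound. Let [m] be the type filling the final state. Along a path
    between two stable states, the number of sites of type [m] minus the
    number of particles of other types climbs from [- K * L] to [K * L] by at
    most one per move, so it takes each intermediate value. Stop when it is
    [1] or [2], the choice being made so that the number of vacancies then has
    the parity of [Gamma]. If that number were below [Gamma], it would be at
    most [Gamma - 2]; but [open_isoperimetry] and [periodic_isoperimetry] say
    that with so few vacancies the two classes differ in size by at least [3],
    or else, on a square torus only, have the same size.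

    These isoperimetric statements come from one estimate, [cyclic_layer]
    (with its open analogue [open_layer]). Suppose that two rows avoid a
    colour and let [p_t] be the number of rows holding more than [t] of its
    cells. A nonempty class of such rows takes up two vacancies per row, and
    on each side the descent to a row that avoids the colour takes up [t + 1]
    more, because of two adjacent rows, the one with fewer cells of the colour
    makes up for the difference with vacancies. Hence [(t + 1) + p_t] is at
    most half the number of vacancies, and summing over [t] bounds the colour
    by a triangular number. The estimate is applied to whichever colour and
    direction fit: [rows_None] counts the vacancies forced by rows and columns
    that avoid a colour, and [missing_cases] concludes that some combination
    is favourable, except on the square torus when each colour is avoided by
    exactly one row and exactly one column. That is the balanced diamond, for
    which [diamond_balanced] shows that the two colours have the same size.

    Upper bound. Fill the sites one after the other with type [m], each time
    emptying beforehand the sites next to the filled part that hold another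
    type. If the filled part always has a frontier of at most [g] sites, the
    number of vacancies grows by at most [g + 1] ([sweep_vacancies]). It grows
    by at most [g] when the first site filled already has type [m] or is empty
    ([sweep_vacancies_strict]): otherwise the filled part would initially have
    consisted of particles of type [m] surrounded by other types, without any
    vacancy in between. Choosing [m] accordingly gives the strict bound for
    configurations that are not stable, and the first bound gives the upper
    half of the equality between stable ones, once there are fillings with a
    frontier of at most [Gamma - 1] sites. Row after row does it, except on a
    square torus, where one has to grow a diamond ([square_plan]). *)

Set Implicit Arguments.
Unset Strict Implicit.
Unset Printing Implicit Defensive.

Import Order.TTheory GRing.Theory Num.Theory.

(** * Lines of coloured cells *)

(** A cell of a line or of a grid is [None] when it is empty, and otherwise
    tells one distinguished particle type from all the others.  Two adjacent
    cells are compatible unless they hold different colours. *)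
Definition compat (x y : option bool) : bool :=
  [|| x == None, y == None | x == y].

Definition count_color (n : nat) (x : option bool) (u : nat -> option bool) : nat :=
  \sum_(j < n) (u j == x).

Lemma count_color_total n u :
  count_color n (Some true) u + count_color n (Some false) u
    + count_color n None u = n.
Proof.
rewrite /count_color -!big_split /= -[RHS]card_ord -sum1_card.
by apply: eq_bigr => i _; case: (u i) => [[]|].
Qed.

Lemma count_color2 n u x :
  count_color n (Some x) u + count_color n (Some (~~ x)) u
    + count_color n None u = n.
Proof.
by rewrite -[RHS](count_color_total n u); case: x => //=; congr (_ + _); rewrite addnC.
Qed.

Lemma sum_bool_gt0P n (P : nat -> bool) :
  reflect (exists2 j, j < n & P j) (0 < \sum_(j < n) P j).
Proof.
apply: (iffP idP) => [|[j jn Pj]]; last by rewrite (bigD1 (Ordinal jn)) //= Pj.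
rewrite lt0n sum_nat_eq0 => /forallPn[j].
by rewrite /= eqb0 negbK => Pj; exists (nat_of_ord j) => //; exact: ltn_ord.
Qed.

Lemma sum_bool_ge2P n (P : nat -> bool) :
  reflect (exists p q, [/\ p < q, q < n, P p & P q]) (1 < \sum_(j < n) P j).
Proof.
apply: (iffP idP) => [|[p [q [pq qn Pp Pq]]]]; last first.
  rewrite (bigD1 (Ordinal (ltn_trans pq qn))) //= Pp.
  rewrite (bigD1 (Ordinal qn)) /=; first by rewrite Pq; lia.
  by rewrite -val_eqE /=; lia.
elim: n => [|n IHn]; first by rewrite big_ord0.
rewrite big_ord_recr /=; case Pn: (P n) => h.
  have /sum_bool_gt0P[p pn Pp] : 0 < \sum_(j < n) P j by move: h; case: (\sum_(j < n) P j).
  by exists p, n.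
have [|p [q [pq qn Pp Pq]]] := IHn; first by rewrite addn0 in h.
by exists p, q; split=> //; lia.
Qed.

Lemma count_color_gt0P n x u :
  reflect (exists2 j, j < n & u j = x) (0 < count_color n x u).
Proof.
by apply: (iffP (sum_bool_gt0P n (fun j => u j == x))) => -[j jn /eqP uj]; exists j.
Qed.

Lemma count_color_ge2 n x u p q :
  p < q -> q < n -> u p = x -> u q = x -> 1 < count_color n x u.
Proof.
move=> pq qn up uq; apply/(sum_bool_ge2P n (fun j => u j == x)).
by exists p, q; rewrite up uq eqxx.
Qed.

(** Without an empty cell in between, the colour could not change. *)
Lemma gap u a b x : a <= b ->
  (forall j, a <= j < b -> compat (u j) (u j.+1)) ->
  u a = Some x -> u b = Some (~~ x) -> exists2 j, a < j < b & u j = None.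
Proof.
elim: b => [|b IHb] ab uc ua ub.
  have a0 : a = 0 by lia.
  by move: ua; rewrite a0 ub; case: (x).
have [a_b|anb] := eqVneq a b.+1; first by move: ua; rewrite a_b ub; case: (x).
have {anb}ab' : a <= b by lia.
case ubE: (u b) => [y|]; last first.
  have [a_b|anb] := eqVneq a b; first by rewrite a_b ubE in ua.
  by exists b => //; lia.
have y_x : y = ~~ x.
  have := uc b; rewrite ubE ub /compat /= ab' ltnS leqnn => /(_ isT).
  by move=> /eqP[].
have uc' j : a <= j < b -> compat (u j) (u j.+1) by move=> jab; apply: uc; lia.
by have [|j jab uj] := IHb ab' uc' ua; [rewrite ubE y_x | exists j => //; lia].
Qed.

Lemma open_line_None n u x :
  (forall j, j.+1 < n -> compat (u j) (u j.+1)) ->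
  0 < count_color n (Some x) u -> 0 < count_color n (Some (~~ x)) u ->
  0 < count_color n None u.
Proof.
move=> uc /count_color_gt0P[i iltn ui] /count_color_gt0P[j jltn uj].
apply/count_color_gt0P; have [ij|ji|ij] := ltngtP i j.
- have [|k kij uk] := gap (ltnW ij) _ ui uj; last by exists k => //; lia.
  by move=> k kij; apply: uc; lia.
- have [| |k kij uk] := @gap u j i (~~ x) (ltnW ji) _ uj; last by exists k => //; lia.
    by move=> k kij; apply: uc; lia.
  by rewrite negbK.
- by move: uj; rewrite -ij ui; case: (x).
Qed.

(** Going around a cycle the colour changes back, so there is a gap on each
    of the two arcs. *)
Lemma cyclic_line_None n u x :
  (forall j, compat (u j) (u j.+1)) -> (forall j, u (j + n) = u j) ->
  0 < count_color n (Some x) u -> 0 < count_color n (Some (~~ x)) u ->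
  1 < count_color n None u.
Proof.
move=> uc un.
suff main y i j : i < j -> j < n -> u i = Some y -> u j = Some (~~ y) ->
    1 < count_color n None u.
  move=> /count_color_gt0P[i iltn ui] /count_color_gt0P[j jltn uj].
  have [ij|ji|ij] := ltngtP i j; first exact: main ui uj.
    by apply: main ji iltn uj _; rewrite negbK.
  by move: uj; rewrite -ij ui; case: (x).
move=> ij jn ui uj.
have [//|p pij up] := gap (ltnW ij) _ ui uj.
have [| | |q qij uq] := @gap u j (i + n) (~~ y) _ _ uj; first by lia.
- by move=> k _; exact: uc.
- by rewrite negbK un.
have [qn|nq] := ltnP q n; first by apply: (@count_color_ge2 _ _ _ p q) => //; lia.
have uqn : u (q - n) = None by rewrite -un subnK.
by apply: (@count_color_ge2 _ _ _ (q - n) p) => //; lia.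
Qed.

(** Sums over a period do not depend on where it starts; this lets arguments
    on a cycle unroll it at a convenient cell. *)
Lemma sum_window n (f : nat -> nat) p : (forall j, f (j + n) = f j) ->
  \sum_(p <= j < p + n) f j = \sum_(j < n) f j.
Proof.
move=> fn; elim: p => [|p IHp]; first by rewrite add0n big_mkord.
rewrite -IHp; case: n fn {IHp} => [|n] fn; first by rewrite !addn0 !big_geq.
rewrite addSn big_nat_recr /=; last by lia.
by rewrite fn [RHS]big_ltn 1?addnC //; lia.
Qed.

Lemma telescope_up (x b : nat -> nat) p q : p <= q ->
  (forall i, p <= i < q -> x i.+1 <= x i + b i) ->
  x q <= x p + \sum_(p <= i < q) b i.
Proof.
elim: q => [|q IHq] pq h.
  by rewrite (_ : p = 0) ?big_geq ?addn0 //; lia.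
have [->|pq'] := eqVneq p q.+1; first by rewrite big_geq ?addn0.
rewrite big_nat_recr /=; last by lia.
have := h q; have := IHq; have : p <= q by lia.
move=> pq2 /(_ pq2) H1 H2; have {}H1 := H1 (fun i hi => h i ltac:(lia)).
by have := H2 ltac:(lia); lia.
Qed.

Lemma telescope_down (x b : nat -> nat) p q : p <= q ->
  (forall i, p <= i < q -> x i <= x i.+1 + b i.+1) ->
  x p <= x q + \sum_(p.+1 <= i < q.+1) b i.
Proof.
elim: q => [|q IHq] pq h.
  by rewrite (_ : p = 0) ?big_geq ?addn0 //; lia.
have [->|pq'] := eqVneq p q.+1; first by rewrite big_geq ?addn0.
rewrite big_nat_recr /=; last by lia.
have := h q; have := IHq; have : p <= q by lia.
move=> pq2 /(_ pq2) H1 H2; have {}H1 := H1 (fun i hi => h i ltac:(lia)).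
by have := H2 ltac:(lia); lia.
Qed.

Definition long_rows (m : nat) (d : nat -> nat) (t : nat) : nat :=
  \sum_(i < m) (t < d i).

Lemma layer_cake m n d : (forall i, i < m -> d i <= n) ->
  \sum_(i < m) d i = \sum_(t < n) long_rows m d t.
Proof.
move=> dn; rewrite exchange_big /=; apply: eq_bigr => i _.
have := dn i (ltn_ord i); elim: n {dn} (d i) => [|n IHn] k kn.
  by rewrite big_ord0; lia.
rewrite big_ord_recr /=; have [nk|kn'] := ltnP n k.
  rewrite (eq_bigr (fun=> 1)) ?sum1_card ?card_ord; first by lia.
  by move=> t _; have := ltn_ord t; lia.
by rewrite -IHn // addn0.
Qed.

Lemma sum_staircase k n : (\sum_(t < n) (k - t.+1)).*2 <= k * k.-1.
Proof.
elim: n k => [|n IHn] k; first by rewrite big_ord0.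
rewrite big_ord_recl /=; case: k => [|k].
  by rewrite big1 // => i _; lia.
rewrite (eq_bigr (fun t : 'I_n => k - t.+1)); last first.
  by move=> t _; rewrite /bump /=; lia.
by have := IHn k; case: k => [|k]; rewrite /=; nia.
Qed.

(** The layers are dominated by the staircase [k - 1, k - 2, ..., 0]. *)
Lemma layer_bound m n d k : (forall i, i < m -> d i <= n) ->
  (forall t, t < n -> 0 < long_rows m d t -> t.+1 + long_rows m d t <= k) ->
  (\sum_(i < m) d i).*2 <= k * k.-1.
Proof.
move=> dn h; rewrite (layer_cake dn); apply: leq_trans (sum_staircase k n).
rewrite leq_double; apply: leq_sum => t _.
by have := h t (ltn_ord t); case: posnP => [-> //|lp /(_ isT)]; lia.
Qed.

(** One step of the staircase has height 2 but carries at most one row, which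
    saves one unit; this is what settles tori whose sides differ by one. *)
Lemma layer_bound_strict m n d k t0 : (forall i, i < m -> d i <= n) ->
  (forall t, t < n -> 0 < long_rows m d t -> t.+1 + long_rows m d t <= k) ->
  t0 < n -> t0.+3 = k -> long_rows m d t0 <= 1 ->
  (\sum_(i < m) d i).*2 + 2 <= k * k.-1.
Proof.
move=> dn h t0n t0k l0; rewrite (layer_cake dn).
apply: leq_trans (sum_staircase k n).
rewrite !(bigD1 (Ordinal t0n) (P := xpredT)) //=.
have : \sum_(t < n | t != Ordinal t0n) long_rows m d t
       <= \sum_(t < n | t != Ordinal t0n) (k - t.+1).
  apply: leq_sum => t _.
  by have := h t (ltn_ord t); case: posnP => [-> //|lp /(_ isT)]; lia.
move: (\sum_(_ < n | _) _) (\sum_(_ < n | _) _) => S1 S2.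
by lia.
Qed.

(** Here [d i] is the number of cells of a colour in row [i] and [b i] the number
    of its vacancies.  From a row above the threshold one reaches a row that
    avoids the colour in both directions, and these are two different rows.
    On each of the two descents the vacancies of the rows at or below the
    threshold add up to the height [t.+1]; the rows above it contribute two
    each, up to the defect [eps]. *)
Lemma cyclic_layer m (d b : nat -> nat) eps p q t :
  (forall i, d (i + m) = d i) -> (forall i, b (i + m) = b i) ->
  (forall i, d i.+1 <= d i + b i) -> (forall i, d i <= d i.+1 + b i.+1) ->
  p < q -> q < m -> d p = 0 -> d q = 0 ->
  \sum_(i < m) (0 < d i) * (2 - b i) <= eps ->
  0 < long_rows m d t ->
  (t.+1 + long_rows m d t).*2 <= \sum_(i < m) b i + eps.
Proof.
move=> dm bm up down pq qm dp dq heps /(sum_bool_gt0P m (fun i => t < d i))[i im ti].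
(* Unroll the cycle at the high row [i]: the two low rows follow it within one period. *)
suff main p' q' : i < p' -> p' < q' -> q' < i + m -> d p' = 0 -> d q' = 0 ->
    (t.+1 + long_rows m d t).*2 <= \sum_(i < m) b i + eps.
  have [ip|pi|ip] := ltngtP i p; last by move: ti; rewrite ip dp.
    by apply: (main p q) => //; lia.
  have [iq|qi|iq] := ltngtP i q; last by move: ti; rewrite iq dq.
    by apply: (main q (p + m)); rewrite ?dm //; lia.
  by apply: (main (p + m) (q + m)); rewrite ?dm //; lia.
move=> ip' pq' qi' dp' dq'.
(* Truncating the profile at the threshold confines the descent to the low rows. *)
pose x j := minn (d j) t.+1; pose bt j := (d j <= t) * b j.
have xup j : x j.+1 <= x j + bt j.
  by rewrite /x /bt; have := up j; case: leqP; lia.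
have xdown j : x j <= x j.+1 + bt j.+1.
  by rewrite /x /bt; have := down j; case: leqP; lia.
have H1 := telescope_down (ltnW ip') (fun j _ => xdown j).
have H2 := telescope_up (ltnW qi') (fun j _ => xup j).
have {H1} H1 : t.+1 <= \sum_(i.+1 <= j < p'.+1) bt j.
  by move: H1; rewrite {1 2}/x dp'; lia.
have {H2} H2 : t.+1 <= \sum_(q' <= j < i + m) bt j.
  by move: H2; rewrite {1 2}/x dm dq'; lia.
have btm j : bt (j + m) = bt j by rewrite /bt dm bm.
have H3 : (t.+1).*2 <= \sum_(j < m) bt j.
  rewrite -(sum_window i btm) (@big_cat_nat _ _ _ i.+1) //=; [|by lia].
  rewrite (@big_cat_nat _ _ _ p'.+1 i.+1) //=; [|by lia..].
  by rewrite (@big_cat_nat _ _ _ q' p'.+1) //=; lia.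
have H4 : (long_rows m d t).*2 <= \sum_(j < m) (t < d j) * b j + eps.
  apply: leq_trans (leq_add (leqnn _) heps).
  rewrite -big_split /= /long_rows -mul2n big_distrr /=.
  by apply: leq_sum => j _; nia.
have H5 : \sum_(j < m) b j = \sum_(j < m) bt j + \sum_(j < m) (t < d j) * b j.
  by rewrite -big_split; apply: eq_bigr => j _; rewrite /bt /=; case: leqP; lia.
by rewrite H5; lia.
Qed.

(** On an open strip there may be only one descent, and a row above the
    threshold is only known to have one vacancy. *)
Lemma open_layer m (d b : nat -> nat) p t :
  (forall i, i.+1 < m -> d i.+1 <= d i + b i) ->
  (forall i, i.+1 < m -> d i <= d i.+1 + b i.+1) ->
  p < m -> d p = 0 -> (forall i, i < m -> 0 < d i -> 0 < b i) ->
  0 < long_rows m d t ->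
  t.+1 + long_rows m d t <= \sum_(i < m) b i.
Proof.
move=> up down pm dp hb /(sum_bool_gt0P m (fun i => t < d i))[i im ti].
pose x j := minn (d j) t.+1; pose bt j := (d j <= t) * b j.
have xup j : j.+1 < m -> x j.+1 <= x j + bt j.
  by move=> /up; rewrite /x /bt; case: leqP; lia.
have xdown j : j.+1 < m -> x j <= x j.+1 + bt j.+1.
  by move=> /down; rewrite /x /bt; case: leqP; lia.
have H3 : t.+1 <= \sum_(j < m) bt j.
  rewrite -(big_mkord xpredT bt).
  have [ip|pi|ip] := ltngtP i p; last by move: ti; rewrite ip dp.
    have H := @telescope_down x bt i p (ltnW ip) (fun j _ => xdown j ltac:(lia)).
    rewrite {1 2}/x dp in H.
    rewrite (@big_cat_nat _ _ _ i.+1) //=; [|by lia..].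
    by rewrite (@big_cat_nat _ _ _ p.+1 i.+1) //=; lia.
  have H := @telescope_up x bt p i (ltnW pi) (fun j _ => xup j ltac:(lia)).
  rewrite {1 2}/x dp in H.
  rewrite (@big_cat_nat _ _ _ p) //=; [|by lia..].
  by rewrite (@big_cat_nat _ _ _ i p) //=; lia.
have H4 : long_rows m d t <= \sum_(j < m) (t < d j) * b j.
  by apply: leq_sum => j _; have := hb j (ltn_ord j); case: ltnP; lia.
have H5 : \sum_(j < m) b j = \sum_(j < m) bt j + \sum_(j < m) (t < d j) * b j.
  by rewrite -big_split; apply: eq_bigr => j _; rewrite /bt /=; case: leqP; lia.
by rewrite H5; lia.
Qed.

(** * Colourings of the discrete torus *)

Implicit Types (c : nat -> nat -> option bool).

Definition area (m n : nat) (x : option bool) c : nat :=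
  \sum_(i < m) count_color n x (c i).

Definition transpose (c : nat -> nat -> option bool) := fun i j => c j i.

Definition missing (m n : nat) (x : bool) c : nat :=
  \sum_(i < m) (count_color n (Some x) (c i) == 0).

(** Torus colourings are periodic functions on the whole grid of pairs of
    naturals, so that translations cost nothing. *)
Definition torus_coloring (m n : nat) c : Prop :=
  [/\ forall i j, compat (c i j) (c i j.+1), forall i j, compat (c i j) (c i.+1 j),
      forall i j, c (i + m) j = c i j & forall i j, c i (j + n) = c i j].

Lemma torus_transpose m n c : torus_coloring m n c -> torus_coloring n m (transpose c).
Proof. by case=> h1 h2 h3 h4; split=> i j; rewrite /transpose. Qed.

Lemma area_transpose m n x c : area n m x (transpose c) = area m n x c.
Proof. exact: exchange_big. Qed.

Lemma area_partition m n x c :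
  area m n (Some x) c + area m n (Some (~~ x)) c + area m n None c = m * n.
Proof.
rewrite /area -!big_split /= (eq_bigr (fun=> n)) ?sum_nat_const ?card_ord //.
by move=> i _; exact: count_color2.
Qed.

Lemma compatC x y : compat x y = compat y x.
Proof. by rewrite /compat orbCA [x == y]eq_sym. Qed.

Lemma count_color_step n x u w : (forall j, j < n -> compat (u j) (w j)) ->
  count_color n (Some x) u <= count_color n (Some x) w + count_color n None w.
Proof.
move=> uw; rewrite /count_color -big_split; apply: leq_sum => j _ /=.
by have := uw j (ltn_ord j); case: (u j) (w j) => [[]|] [[]|]; case: (x).
Qed.

Lemma count_color_periodic m n x c i :
  (forall i j, c (i + m) j = c i j) ->
  count_color n x (c (i + m)) = count_color n x (c i).
Proof. by move=> cm; apply: eq_bigr => j _; rewrite cm. Qed.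

(** A cell at which a row avoiding one colour meets a column avoiding the
    other is empty. *)
Lemma crossing m n x c i : i < m -> count_color n (Some (~~ x)) (c i) = 0 ->
  missing n m x (transpose c) <= count_color n None (c i).
Proof.
move=> im ci0; apply: leq_sum => j _.
case cij: (c i j) => [y|] //; last by case: (_ == 0).
suff y_x : y = x.
  have : 0 < count_color m (Some x) (transpose c j).
    by apply/count_color_gt0P; exists i => //; rewrite /transpose cij y_x.
  by case: (count_color _ _ _).
apply/eqP; apply: contraT => y_nx.
have : 0 < count_color n (Some (~~ x)) (c i).
  apply/count_color_gt0P; exists j; first exact: ltn_ord.
  by rewrite cij; case: (x) (y) y_nx => [] [].
by rewrite ci0.
Qed.

(** A row filled with one colour forces the next row to avoid the other
    colour as well. *)
Lemma missing_full_row m n x c i : torus_coloring m n c -> 1 < m -> i < m ->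
  count_color n (Some x) (c i) = 0 -> count_color n None (c i) = 0 ->
  1 < missing m n x c.
Proof.
move=> [_ cv cm _] m1 im ci0 ciN.
apply/(sum_bool_ge2P m (fun i => count_color n (Some x) (c i) == 0)).
have ci1 : count_color n (Some x) (c i.+1) = 0.
  have h : forall j, j < n -> compat (c i.+1 j) (c i j) by move=> j _; rewrite compatC.
  by have := count_color_step x h; lia.
have [im1|] := ltnP i.+1 m; first by exists i, i.+1; rewrite ci0 ci1; split.
move=> mi; exists 0, i; rewrite ci0; split=> //; first by lia.
by rewrite -(count_color_periodic n (Some x) 0 cm) -(_ : i.+1 = 0 + m) ?ci1 //; lia.
Qed.

(** A row with both colours has two gaps.  A row that avoids a colour is
    empty where it crosses the columns avoiding the other colour, and is not
    filled if it is the only row avoiding its colour. *)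
Lemma row_None m n x c i : torus_coloring m n c -> 1 < m -> 1 < n -> i < m ->
  2 <= count_color n None (c i)
    + (count_color n (Some x) (c i) == 0)
      * (2 - maxn (missing n m (~~ x) (transpose c)) (missing m n x c == 1))
    + (count_color n (Some (~~ x)) (c i) == 0)
      * (2 - maxn (missing n m x (transpose c)) (missing m n (~~ x) c == 1)).
Proof.
move=> ct m1 n1 im; have [ch cv cm cn] := ct.
have tot := count_color2 n (c i) x.
have [cx|cx] := posnP (count_color n (Some x) (c i));
  have [cy|cy] := posnP (count_color n (Some (~~ x)) (c i)).
- by lia.
- have := @crossing m n (~~ x) c i im; rewrite negbK => /(_ cx) H.
  have H2 : (missing m n x c == 1) <= count_color n None (c i).
    case: eqP => // m_1; rewrite lt0n; apply/eqP => cN.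
    by have := missing_full_row ct m1 im cx cN; rewrite m_1.
  by lia.
- have H := @crossing m n x c i im cy.
  have H2 : (missing m n (~~ x) c == 1) <= count_color n None (c i).
    case: eqP => // m_1; rewrite lt0n; apply/eqP => cN.
    by have := missing_full_row ct m1 im cy cN; rewrite m_1.
  by lia.
- by have := cyclic_line_None (ch i) (cn i) cx cy; lia.
Qed.

Lemma rows_None m n x c : torus_coloring m n c -> 1 < m -> 1 < n ->
  2 * m <= area m n None c
    + missing m n x c
      * (2 - maxn (missing n m (~~ x) (transpose c)) (missing m n x c == 1))
    + missing m n (~~ x) c
      * (2 - maxn (missing n m x (transpose c)) (missing m n (~~ x) c == 1)).
Proof.
move=> ct m1 n1; set al := 2 - _; set be := 2 - _.
rewrite [X in X * al]/missing [X in X * be]/missing !big_distrl -!big_split /=.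
apply: leq_trans (_ : \sum_(i < m) 2 <= _).
  by rewrite sum_nat_const card_ord mulnC.
by apply: leq_sum => i _; apply: row_None.
Qed.

Lemma torus_layer m n x c eps t : torus_coloring m n c ->
  1 < missing m n x c ->
  \sum_(i < m) (0 < count_color n (Some x) (c i)) * (2 - count_color n None (c i))
    <= eps ->
  0 < long_rows m (fun i => count_color n (Some x) (c i)) t ->
  (t.+1 + long_rows m (fun i => count_color n (Some x) (c i)) t).*2
    <= area m n None c + eps.
Proof.
move=> [ch cv cm cn].
move=> /(sum_bool_ge2P m (fun i => count_color n (Some x) (c i) == 0)).
move=> [p [q [pq qm /eqP cp /eqP cq]]] heps hl.
apply: (@cyclic_layer m _ (fun i => count_color n None (c i)) eps p q) => //.
- by move=> i; exact: count_color_periodic.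
- by move=> i; exact: count_color_periodic.
- move=> i; apply: leq_trans (@count_color_step n x (c i.+1) (c i) _) _ => //.
  by move=> j _; rewrite compatC.
- by move=> i; exact: (@count_color_step n x (c i) (c i.+1)).
Qed.

Lemma count_color_le n x u : count_color n x u <= n.
Proof.
rewrite -[leqRHS]card_ord -sum1_card; apply: leq_sum => j _; exact: leq_b1.
Qed.

(** If two rows avoid [x], the layer estimate applies without defect as soon
    as no row with [x] has fewer than two vacancies: either because all of
    them contain the other colour, or because two columns avoid [x]. *)
Lemma small_color m n x c k : torus_coloring m n c ->
  1 < missing m n x c ->
  missing m n (~~ x) c = 0 \/ 1 < missing n m x (transpose c) ->
  area m n None c <= k.*2.+1 ->
  (area m n (Some x) c).*2 <= k * k.-1.
Proof.
move=> ct r2 alt bk; have [ch cv cm cn] := ct.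
have heps : \sum_(i < m) (0 < count_color n (Some x) (c i))
    * (2 - count_color n None (c i)) <= 0.
  rewrite leqn0 big1 // => i _; have im := ltn_ord i.
  have [//|cx] := posnP (count_color n (Some x) (c i)).
  rewrite mul1n; apply/eqP; rewrite subn_eq0.
  have [cy|cy] := posnP (count_color n (Some (~~ x)) (c i)); last first.
    exact: cyclic_line_None (ch i) (cn i) cx cy.
  case: alt => [/eqP|] alt; last exact: leq_trans alt (crossing im cy).
  move: alt; rewrite sum_nat_eq0 => /forallP/(_ i) /=.
  by rewrite cy.
apply: (@layer_bound m n (fun i => count_color n (Some x) (c i))) => [i _|t _ lp].
  exact: count_color_le.
by have := torus_layer ct r2 heps lp; lia.
Qed.

(** A row containing [x] with fewer than two vacancies avoids the other
    colour; if there is only one such row the defect is one.  The saving for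
    [2 < n] comes from the threshold [n - 3]: a row above it has no room for
    two gaps and a cell of the other colour. *)
Lemma small_color_one_bad_row m n x c : torus_coloring m n c -> 1 < m ->
  1 < missing m n x c -> missing m n (~~ x) c <= 1 ->
  area m n None c < n.*2 ->
  (area m n (Some x) c).*2 + (2 < n).*2 <= n * n.-1.
Proof.
move=> ct m1 r2 r'1 bn; have [ch cv cm cn] := ct.
have heps : \sum_(i < m) (0 < count_color n (Some x) (c i))
    * (2 - count_color n None (c i)) <= 1.
  apply: (leq_trans _ r'1); apply: leq_sum => i _; have im := ltn_ord i.
  have [//|cx] := posnP (count_color n (Some x) (c i)).
  rewrite mul1n.
  have [cy|cy] := posnP (count_color n (Some (~~ x)) (c i)); last first.
    by have := cyclic_line_None (ch i) (cn i) cx cy; lia.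
  rewrite ?cy ?eqxx leq_subLR addn1 ltnS lt0n; apply/eqP => cN.
  by have := missing_full_row ct m1 im cy cN; rewrite ltnNge r'1.
have hl t : t < n ->
    0 < long_rows m (fun i => count_color n (Some x) (c i)) t ->
    t.+1 + long_rows m (fun i => count_color n (Some x) (c i)) t <= n.
  by move=> _ lp; have := torus_layer ct r2 heps lp; lia.
have dn i : i < m -> count_color n (Some x) (c i) <= n.
  by move=> _; exact: count_color_le.
have [n3|n3] := ltnP 2 n; last first.
  by rewrite addn0; exact: (layer_bound dn hl).
(* The staircase has height 2 at this threshold. *)
apply: (layer_bound_strict dn hl (t0 := n - 3)); rewrite ?prednK; try lia.
apply: (leq_trans _ r'1); apply: leq_sum => i _.
case: ltnP => // cx; rewrite lt0b; apply/eqP.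
have [//|cy] := posnP (count_color n (Some (~~ x)) (c i)).
have tot := count_color2 n (c i) x.
have cx0 : 0 < count_color n (Some x) (c i) by lia.
by have := cyclic_line_None (ch i) (cn i) cx0 cy; lia.
Qed.

(** * The balanced diamond *)

Lemma run_color u a b k y : a <= k < b ->
  (forall j, compat (u j) (u j.+1)) -> u k = Some y ->
  \sum_(a <= j < b) (u j == None) = 0 ->
  forall j, a <= j < b -> u j = Some y.
Proof.
move=> kab uc uk /eqP; rewrite sum_nat_seq_eq0 => /allP no j jab.
have {}no i : a <= i < b -> u i <> None.
  by move=> iab uN; have /= := no i; rewrite mem_index_iota iab uN eqxx => /(_ isT).
case uj: (u j) => [z|]; last by case: (no j).
congr Some; apply/eqP; apply: contraT => zy.
have {zy}z_y : z = ~~ y by case: (z) (y) zy => [] [].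
have [jk|kj|jk] := ltngtP j k; last by move: z_y uj; rewrite jk uk => -> []; case: (y).
  have uk' : u k = Some (~~ z) by rewrite uk z_y negbK.
  by have [//|i ij /no[]] := gap (ltnW jk) _ uj uk'; lia.
have uj' : u j = Some (~~ y) by rewrite uj z_y.
by have [//|i ij /no[]] := gap (ltnW kj) _ uk uj'; lia.
Qed.

Lemma run_weight u a b k x y F : a <= k < b ->
  (forall j, compat (u j) (u j.+1)) -> u k = Some y ->
  \sum_(a <= j < b) (u j == None) = 0 ->
  \sum_(a <= j < b) ((u j == Some x) + (u j == None) * F j) = (y == x) * (b - a).
Proof.
move=> kab uc uk no; have uy := run_color kab uc uk no.
rewrite (@eq_big_nat _ _ _ _ _ _ (fun=> nat_of_bool (y == x))).
  by rewrite sum_nat_const_nat mulnC.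
by move=> j /uy -> /=; rewrite addn0.
Qed.

(** In a row made of one arc of each colour, the number of cells of colour [x]
    is [n - 1] minus the distance between the two gaps; measuring the distance
    from the reference cell [q] splits it into one weight per gap. *)
Lemma two_gap_row n u p q x F : p < q < p + n ->
  (forall j, compat (u j) (u j.+1)) -> (forall j, u (j + n) = u j) ->
  u p = Some x -> u q = Some (~~ x) -> count_color n None u = 2 ->
  (forall j, p < j < q -> F j = q - j) ->
  (forall j, q < j < p + n -> F j = j - q) ->
  \sum_(p <= j < p + n) ((u j == Some x) + (u j == None) * F j) = n - 1.
Proof.
move=> pqn uc un up uq u2 F1 F2.
have [|//|z1 hz1 uz1] := @gap u p q x _ _ up uq; first by lia.
have upn : u (p + n) = Some (~~ ~~ x) by rewrite un negbK.
have [|//|z2 hz2 uz2] := @gap u q (p + n) (~~ x) _ _ uq upn; first by lia.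
have cut (g : nat -> nat) : \sum_(p <= j < p + n) g j =
    \sum_(p <= j < z1) g j + g z1 + \sum_(z1.+1 <= j < z2) g j + g z2
      + \sum_(z2.+1 <= j < p + n) g j.
  rewrite (@big_cat_nat _ _ _ z1) //=; [|by lia..].
  rewrite (@big_ltn _ _ _ z1) /=; [|by lia].
  rewrite (@big_cat_nat _ _ _ z2 z1.+1) //=; [|by lia..].
  by rewrite (@big_ltn _ _ _ z2) /=; [lia|by lia].
have := u2; rewrite /count_color.
rewrite -(@sum_window n (fun j => u j == None) p) ?cut; last by move=> j; rewrite un.
rewrite uz1 uz2 /= => h.
have [h1 h2 h3] : [/\ \sum_(p <= j < z1) (u j == None) = 0,
    \sum_(z1.+1 <= j < z2) (u j == None) = 0
    & \sum_(z2.+1 <= j < p + n) (u j == None) = 0].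
  move: h; move: (\sum_(p <= j < z1) _) (\sum_(z1.+1 <= j < z2) _).
  by move: (\sum_(z2.+1 <= j < _) _) => S1 S2 S3; split; lia.
have hp : p <= p < z1 by lia.
have hq : z1 < q < z2 by lia.
rewrite (run_weight x F hp uc up h1) (run_weight x F hq uc uq h2).
have h3' : \sum_(z2.+1 <= j < (p + n).+1) (u j == None) = 0.
  by rewrite big_nat_recr /= ?h3 ?upn //; lia.
have hn : z2 < p + n < (p + n).+1 by lia.
have := run_weight x F hn uc upn h3'.
rewrite big_nat_recr /=; last by lia.
rewrite upn !negbK !eqxx /= addn0 F1 // F2 //.
by move: (\sum_(z2.+1 <= j < _) _) => S; case: (x) => /=; lia.
Qed.

Lemma one_gap_row n u p z x F : p <= z < p + n ->
  (forall j, u (j + n) = u j) -> u z = None -> count_color n None u = 1 ->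
  \sum_(p <= j < p + n) ((u j == Some x) + (u j == None) * F j)
    = count_color n (Some x) u + F z.
Proof.
move=> hz un uz u1; rewrite big_split /=; congr (_ + _).
  by rewrite (@sum_window n (fun j => u j == Some x) p) // => j; rewrite un.
have cut (g : nat -> nat) : \sum_(p <= j < p + n) g j =
    \sum_(p <= j < z) g j + g z + \sum_(z.+1 <= j < p + n) g j.
  rewrite (@big_cat_nat _ _ _ z) //=; [|by lia..].
  by rewrite (@big_ltn _ _ _ z) /= ?addnA //; lia.
have := u1; rewrite /count_color.
rewrite -(@sum_window n (fun j => u j == None) p) ?cut; last by move=> j; rewrite un.
rewrite uz /= mul1n => h.
have no a b : \sum_(a <= j < b) (u j == None) = 0 ->
    \sum_(a <= j < b) (u j == None) * F j = 0.
  move=> /eqP; rewrite sum_nat_seq_eq0 => /allP no.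
  apply/eqP; rewrite sum_nat_seq_eq0; apply/allP => j /no /=.
  by case: (_ == None).
have [h1 h2] : \sum_(p <= j < z) (u j == None) = 0 /\
    \sum_(z.+1 <= j < p + n) (u j == None) = 0.
  move: h; move: (\sum_(p <= j < z) _) (\sum_(z.+1 <= j < _) _) => S1 S2.
  by split; lia.
by rewrite !no // addn0.
Qed.

Lemma sum_ramp h : \sum_(1 <= t < h) t.*2 = h * h.-1.
Proof.
elim: h => [|[|h] IHh]; first by rewrite big_geq.
  by rewrite big_geq.
by rewrite big_nat_recr //= IHh /=; nia.
Qed.

(** The total weight of the columns on one side of the reference column. *)
Lemma sum_ramp_down p q : p < q ->
  \sum_(p.+1 <= j < q) (q - j).*2 = (q - p) * (q - p).-1.
Proof.
move=> pq; rewrite -sum_ramp big_nat_rev /= [RHS]big_add1.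
rewrite [LHS](_ : _ = \sum_(0 + p.+1 <= j < q) (q - (p.+1 + q - j.+1)).*2) //.
rewrite big_addn big_mkord [RHS]big_mkord (_ : (q - p).-1 = q - p.+1); last by lia.
by apply: eq_bigr => j _; have := ltn_ord j; lia.
Qed.

Lemma sum_ramp_up q r : q < r ->
  \sum_(q.+1 <= j < r) (j - q).*2 = (r - q) * (r - q).-1.
Proof.
move=> qr; rewrite -sum_ramp [RHS]big_add1.
rewrite [LHS](_ : _ = \sum_(0 + q.+1 <= j < r) (j - q).*2) //.
rewrite big_addn big_mkord [RHS]big_mkord (_ : (r - q).-1 = r - q.+1); last by lia.
by apply: eq_bigr => j _; have := ltn_ord j; lia.
Qed.

(** Summing the row identities and exchanging the sums, the weight of each
    column is counted once for each of its vacancies, that is, twice except in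
    the columns [p] and [q].  The resulting area depends only on the distance [q - p] between the column
    without [~~ x] and the column without [x].  The weight [n.-1] at column [p]
    makes the identity hold also in the row that avoids [x], whose only vacancy
    is there. *)
Lemma diamond_half n c x p q : torus_coloring n n c -> p < q < p + n ->
  (forall i, i < n ->
     [\/ [/\ c i p = Some x, c i q = Some (~~ x) & count_color n None (c i) = 2],
         [/\ c i q = None, count_color n (Some (~~ x)) (c i) = 0
           & count_color n None (c i) = 1]
       | [/\ c i p = None, count_color n (Some x) (c i) = 0
           & count_color n None (c i) = 1]]) ->
  count_color n None (transpose c p) = 1 ->
  (forall j, p < j < p + n -> j != q -> count_color n None (transpose c j) = 2) ->
  area n n (Some x) c + n.-1 + (q - p) * (q - p).-1 + (n - (q - p)) * (n - (q - p)).-1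
    = n * n.-1.
Proof.
move=> [ch cv cm cn] pqn rows colp cols.
(* The distance to the column [q], except at [p]. *)
pose F (j : nat) : nat := if j == p then n.-1 else if j < q then q - j else j - q.
have rowE i : i < n ->
    \sum_(p <= j < p + n) ((c i j == Some x) + (c i j == None) * F j) = n.-1.
  move=> im; have tot := count_color2 n (c i) x.
  case: (rows i im) => [[cp cq c2]|[cq cx c1]|[cp cx c1]].
  - rewrite (two_gap_row pqn (ch i) (cn i) cp cq c2) ?subn1 // => j hj.
      by rewrite /F; case: eqP => [|_]; [lia|case: ltnP; lia].
    by rewrite /F; case: eqP => [|_]; [lia|case: ltnP; lia].
  - rewrite (@one_gap_row n (c i) p q x F _ (cn i) cq c1); last by lia.
    rewrite /F; case: eqP => [|_]; first by lia.
    by move: tot; rewrite ltnn subnn cx c1; case: (n) => [|k]; rewrite /=; lia.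
  rewrite (@one_gap_row n (c i) p p x F _ (cn i) cp c1); last by lia.
  by rewrite /F eqxx cx.
have E : \sum_(i < n) \sum_(p <= j < p + n) ((c i j == Some x) + (c i j == None) * F j)
    = n * n.-1.
  rewrite (eq_bigr (fun=> n.-1)) ?sum_nat_const ?card_ord // => i _.
  exact: rowE.
rewrite -E.
have -> : \sum_(i < n) \sum_(p <= j < p + n)
      ((c i j == Some x) + (c i j == None) * F j)
    = area n n (Some x) c
      + \sum_(p <= j < p + n) count_color n None (transpose c j) * F j.
  transitivity (\sum_(i < n) (\sum_(p <= j < p + n) (c i j == Some x)
      + \sum_(p <= j < p + n) (c i j == None) * F j)).
    by apply: eq_bigr => i _; rewrite big_split.
  rewrite big_split /=; congr (_ + _).
    apply: eq_bigr => i _.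
    by rewrite (@sum_window n (fun j => c i j == Some x) p) // => j; rewrite cn.
  rewrite exchange_big /=; apply: eq_bigr => j _.
  by rewrite big_distrl.
have -> : \sum_(p <= j < p + n) count_color n None (transpose c j) * F j
    = n.-1 + (\sum_(p.+1 <= j < q) (q - j).*2 + \sum_(q.+1 <= j < p + n) (j - q).*2).
  rewrite big_ltn; last by lia.
  rewrite colp mul1n {1}/F eqxx; congr (_ + _).
  rewrite (@big_cat_nat _ _ _ q) //=; [|by lia..]; congr (_ + _).
    apply: eq_big_nat => j hj; rewrite cols; [|by lia|by lia].
    by rewrite /F; case: eqP => [|_]; [lia|case: ltnP; lia].
  rewrite big_ltn; last by lia.
  rewrite {1}/F; case: eqP => [|_]; first by lia.
  rewrite ltnn subnn muln0 add0n.
  apply: eq_big_nat => j hj; rewrite cols; [|by lia|by lia].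
  by rewrite /F; case: eqP => [|_]; [lia|case: ltnP; lia].
rewrite sum_ramp_down; last by lia.
rewrite sum_ramp_up; last by lia.
rewrite (_ : p + n - q = n - (q - p)); last by lia.
by rewrite !addnA.
Qed.

Lemma eq_of_sum_le n (f g : nat -> nat) :
  (forall i, i < n -> f i <= g i) -> \sum_(i < n) g i <= \sum_(i < n) f i ->
  forall i, i < n -> f i = g i.
Proof.
move=> fg h i im; apply/eqP; rewrite eqn_leq fg //= leqNgt; apply/negP => lt_fg.
move: h; rewrite leqNgt => /negP[].
rewrite !(bigD1 (Ordinal im) (P := xpredT)) //= -addSn leq_add //.
by apply: leq_sum => j _; apply: fg.
Qed.

(** The inequalities of [row_None] are all equalities, since their sum is. *)
Lemma diamond_rows n c x : torus_coloring n n c -> 1 < n ->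
  missing n n x c = 1 -> missing n n (~~ x) c = 1 ->
  missing n n x (transpose c) = 1 -> missing n n (~~ x) (transpose c) = 1 ->
  area n n None c + 2 <= n.*2 ->
  forall i, i < n ->
    count_color n None (c i) + (count_color n (Some x) (c i) == 0)
      + (count_color n (Some (~~ x)) (c i) == 0) = 2.
Proof.
move=> ct n1 r r' k k' bn i im.
apply/esym; apply: (@eq_of_sum_le n (fun=> 2) (fun i =>
    count_color n None (c i) + (count_color n (Some x) (c i) == 0)
      + (count_color n (Some (~~ x)) (c i) == 0))) im => [{}i im|].
  have := row_None x ct n1 n1 im.
  by rewrite r r' k k' eqxx /= !muln1.
rewrite !big_split /= sum_nat_const card_ord.
by move: r r'; rewrite /missing => -> ->; move: bn; rewrite /area -addnA muln2.
Qed.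

Lemma missing1_ex m n x c : missing m n x c = 1 ->
  exists2 i, i < m & count_color n (Some x) (c i) = 0.
Proof.
move=> r; have : 0 < missing m n x c by rewrite r.
move=> /(sum_bool_gt0P m (fun i => count_color n (Some x) (c i) == 0)).
by case=> i im /eqP ci; exists i.
Qed.

Lemma missing1_uniq m n x c i j : missing m n x c = 1 -> i < m -> j < m ->
  count_color n (Some x) (c i) = 0 -> count_color n (Some x) (c j) = 0 -> i = j.
Proof.
move=> r im jm ci cj; have two p q : p < q -> q < m ->
    count_color n (Some x) (c p) = 0 -> count_color n (Some x) (c q) = 0 -> False.
  move=> pq qm cp cq; suff : 1 < missing m n x c by rewrite r.
  apply/(sum_bool_ge2P m (fun i => count_color n (Some x) (c i) == 0)).
  by exists p, q; rewrite cp cq.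
by have [ij|ji|//] := ltngtP i j; [case: (two i j)|case: (two j i)].
Qed.

Lemma count_color0 n x u j : count_color n x u = 0 -> j < n -> u j <> x.
Proof.
move=> u0 jn uj; suff : 0 < count_color n x u by rewrite u0.
by apply/count_color_gt0P; exists j.
Qed.

(** The area found in [diamond_half] is symmetric under replacing [q - p] by
    its complement [n - (q - p)], which is what exchanging the two colours
    does. *)
Lemma diamond_balanced n c : torus_coloring n n c -> 1 < n ->
  (forall x, missing n n x c = 1) -> (forall x, missing n n x (transpose c) = 1) ->
  area n n None c + 2 <= n.*2 ->
  area n n (Some true) c = area n n (Some false) c.
Proof.
move=> ct n1 r k bn; have [ch cv cm cn] := ct.
have rowT x i := @diamond_rows n c x ct n1 (r x) (r (~~ x)) (k x) (k (~~ x)) bn i.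
have colT x j : j < n -> count_color n None (transpose c j)
      + (count_color n (Some x) (transpose c j) == 0)
      + (count_color n (Some (~~ x)) (transpose c j) == 0) = 2.
  apply: (@diamond_rows n (transpose c) x) => //; first exact: torus_transpose.
  by rewrite area_transpose.
have missN x u : count_color n (Some x) u = 0 ->
    count_color n None u + (count_color n (Some (~~ x)) u == 0)
      + (count_color n (Some x) u == 0) = 2 -> count_color n None u = 1.
  move=> ux; have := count_color2 n u x; rewrite ux eqxx /= add0n.
  by case: (count_color n (Some (~~ x)) u) => [|y] /=; lia.
have half x p q : p < n -> q < n -> p != q ->
    count_color n (Some (~~ x)) (transpose c p) = 0 ->
    count_color n (Some x) (transpose c q) = 0 ->
    forall q', q' = q \/ q' = q + n -> p < q' < p + n ->
    area n n (Some x) c + n.-1 + (q' - p) * (q' - p).-1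
      + (n - (q' - p)) * (n - (q' - p)).-1 = n * n.-1.
  move=> pn qn pq cp cq q' q'q hq'.
  have q'c i : c i q' = c i q by case: q'q => ->; rewrite ?cn.
  have colp : count_color n None (transpose c p) = 1.
    by apply: missN cp _; rewrite negbK colT.
  have colq : count_color n None (transpose c q) = 1.
    by apply: missN cq _; have := colT x q qn; lia.
  have [i1 i1n ri1] := missing1_ex (r x).
  have [i2 i2n ri2] := missing1_ex (r (~~ x)).
  have None2 i j l : i < n -> l < n -> i != l -> c i j = None -> c l j = None ->
      1 < count_color n None (transpose c j).
    rewrite neq_ltn => im lm /orP[il|li] ci cl.
      exact: count_color_ge2 il lm ci cl.
    exact: count_color_ge2 li im cl ci.
  have cross i j y : i < n -> j < n -> count_color n (Some y) (c i) = 0 ->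
      count_color n (Some (~~ y)) (transpose c j) = 0 -> c i j = None.
    move=> im jn ci cj; have := count_color0 ci jn; have := count_color0 cj im.
    by rewrite /transpose; case: (c i j) => // [[]]; case: (y).
  have c1p : c i1 p = None by exact: cross cp.
  have c2q : c i2 q = None by apply: cross ri2 _ => //; rewrite negbK.
  apply: diamond_half => // [i im|j hj jq].
    rewrite !q'c; have rT := rowT x i im.
    have [cx|cx] := posnP (count_color n (Some x) (c i)).
      apply: Or33; rewrite cx; split=> //; first exact: cross cp.
      by apply: missN cx _; lia.
    have [cy|cy] := posnP (count_color n (Some (~~ x)) (c i)).
      apply: Or32; split=> //; first by apply: cross cy _ => //; rewrite negbK.
      by apply: missN cy _; rewrite negbK; lia.
    have ii1 : i != i1 by apply: contraTneq cx => ->; rewrite ri1.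
    have ii2 : i != i2 by apply: contraTneq cy => ->; rewrite ri2.
    apply: Or31; split; last by lia.
      case cip: (c i p) => [y|].
        have := count_color0 cp im; rewrite /transpose cip.
        by case: (x) (y) => [] [].
      by have := None2 i p i1 im i1n ii1 cip c1p; rewrite colp.
    case ciq: (c i q) => [y|].
      have := count_color0 cq im; rewrite /transpose ciq.
      by case: (x) (y) => [] [].
    by have := None2 i q i2 im i2n ii2 ciq c2q; rewrite colq.
  have [j' [j'n j'p j'q j'c]] : exists j', [/\ j' < n, j' != p, j' != q
      & forall i, c i j = c i j'].
    have [jn|nj] := ltnP j n; first by exists j; split=> //; lia.
    exists (j - n); split; try lia.
    by move=> i; rewrite -[in LHS](subnK nj) cn.
  rewrite (_ : count_color n None (transpose c j)
             = count_color n None (transpose c j')); last first.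
    by apply: eq_bigr => i _; rewrite /transpose j'c.
  have rT := colT x j' j'n.
  have [cx|cx] := posnP (count_color n (Some x) (transpose c j')).
    by case/eqP: j'q; apply: missing1_uniq (k x) _ _ cx cq.
  have [cy|cy] := posnP (count_color n (Some (~~ x)) (transpose c j')).
    by case/eqP: j'p; apply: missing1_uniq (k (~~ x)) _ _ cy cp.
  by lia.
have [p pn cp] := missing1_ex (k false).
have [q qn cq] := missing1_ex (k true).
have pq : p != q.
  apply/eqP => pq; rewrite -pq in cq.
  have := colT true p pn; have := count_color2 n (transpose c p) true.
  by rewrite /= cp cq /=; lia.
have Ht := half true p q pn qn pq cp cq.
have Hf := half false q p qn pn _ cq cp.
rewrite eq_sym in pq; have {}Hf := Hf pq.
have [pltq|qltp|pq'] := ltngtP p q; last by rewrite pq' eqxx in pq.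
  have := Ht q (or_introl erefl) ltac:(lia).
  have := Hf (p + n) (or_intror erefl) ltac:(lia).
  rewrite (_ : p + n - q = n - (q - p)); last by lia.
  rewrite (_ : n - (n - (q - p)) = q - p); last by lia.
  by move: ((q - p) * _) ((n - _) * _); lia.
have := Hf p (or_introl erefl) ltac:(lia).
have := Ht (q + n) (or_intror erefl) ltac:(lia).
rewrite (_ : q + n - p = n - (p - q)); last by lia.
rewrite (_ : n - (n - (p - q)) = p - q); last by lia.
by move: ((p - q) * _) ((n - _) * _); lia.
Qed.

(** * The isoperimetric gap *)

(** Here [r], [r'], [k], [k'] count the rows and the columns that avoid the first
    and the second colour.  In the first four cases [small_color] applies, in
    the next four [small_color_one_bad_row], and the last one is the diamond. *)
Lemma missing_cases m n b r r' k k' :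
  b < (minn m n).*2 -> (m = n -> b.+2 <= m.*2) ->
  2 * m <= b + r * (2 - maxn k' (r == 1)) + r' * (2 - maxn k (r' == 1)) ->
  2 * n <= b + k * (2 - maxn r' (k == 1)) + k' * (2 - maxn r (k' == 1)) ->
  (1 < r /\ (r' = 0 \/ 1 < k)) \/ (1 < r' /\ (r = 0 \/ 1 < k')) \/
  (1 < k /\ (k' = 0 \/ 1 < r)) \/ (1 < k' /\ (k = 0 \/ 1 < r')) \/
  (n < m /\ 1 < r /\ r' <= 1) \/ (n < m /\ 1 < r' /\ r <= 1) \/
  (m < n /\ 1 < k /\ k' <= 1) \/ (m < n /\ 1 < k' /\ k <= 1) \/
  (m = n /\ r = 1 /\ r' = 1 /\ k = 1 /\ k' = 1).
Proof.
move=> b1 b2.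
case: r => [|[|r]]; case: r' => [|[|r']]; case: k => [|[|k]]; case: k' => [|[|k']];
 rewrite /= ?maxn0 ?max0n ?maxnn ?subn0 ?subnn ?muln0 ?mul0n ?addn0 ?add0n => R C;
 lia.
Qed.

(** The bound on [a] is the one given by [small_color]; the margin is least on
    the square torus of side 3. *)
Lemma small_color_margin m n b a d : 1 < m -> 1 < n -> 6 <= m + n ->
  a + d + b = m * n -> b < (minn m n).*2 -> (m = n -> b.+2 <= m.*2) ->
  a.*2 <= (minn m n).-1 * (minn m n).-1.-1 -> a + 3 <= d.
Proof.
wlog le_mn : m n / m <= n => [W|].
  move=> m1 n1 mn tot b1 b2; case/orP: (leq_total m n) => [/W|nm]; first by auto.
  rewrite minnC; apply: (W n m nm); rewrite ?(minnC n m) ?(addnC n m) ?(mulnC n m) //.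
  by move=> nm'; rewrite nm' in b2 *; exact: b2.
rewrite (minn_idPl le_mn) => m1 n1 mn tot b1 b2 ha.
case: m m1 le_mn mn tot b1 b2 ha => [|[|s]] // _ le_mn mn tot b1 b2 /= ha.
have [e|ne] := eqVneq s.+2 n.
  by have := b2 e; rewrite -e in tot mn; nia.
have lt : s.+3 <= n by lia.
have : s.+2 * s.+3 <= s.+2 * n by rewrite leq_mul2l lt orbT.
by nia.
Qed.

Lemma one_bad_row_margin m n b a d : 1 < n -> n < m -> 6 <= m + n ->
  a + d + b = m * n -> b < n.*2 -> a.*2 + (2 < n).*2 <= n * n.-1 -> a + 3 <= d.
Proof.
move=> n1 nm mn tot b1 ha.
case: n n1 nm mn tot b1 ha => [|[|[|s]]] // _ nm mn tot b1 /= ha; first by nia.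
have : s.+4 * s.+3 <= m * s.+3 by rewrite leq_mul2r nm orbT.
by nia.
Qed.

Lemma periodic_isoperimetry m n c : torus_coloring m n c ->
  1 < m -> 1 < n -> 6 <= m + n ->
  area m n None c < (minn m n).*2 -> (m = n -> (area m n None c).+2 <= m.*2) ->
  area m n (Some true) c + 3 <= area m n (Some false) c \/
  area m n (Some false) c + 3 <= area m n (Some true) c \/
  m = n /\ area m n (Some true) c = area m n (Some false) c.
Proof.
move=> ct m1 n1 mn b1 b2; have ctt := torus_transpose ct.
have goalP x : area m n (Some x) c + 3 <= area m n (Some (~~ x)) c ->
    area m n (Some true) c + 3 <= area m n (Some false) c \/
    area m n (Some false) c + 3 <= area m n (Some true) c \/
    m = n /\ area m n (Some true) c = area m n (Some false) c.
  by case: x; [left | right; left].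
have tot x := area_partition m n x c.
have b1' : area m n None c <= (minn m n).-1.*2.+1 by lia.
have sm x : (area m n (Some x) c).*2 <= (minn m n).-1 * (minn m n).-1.-1 ->
    area m n (Some x) c + 3 <= area m n (Some (~~ x)) c.
  by move=> h; apply: small_color_margin m1 n1 mn (tot x) b1 b2 h.
have rows x : 1 < missing m n x c ->
    missing m n (~~ x) c = 0 \/ 1 < missing n m x (transpose c) ->
    area m n (Some x) c + 3 <= area m n (Some (~~ x)) c.
  by move=> r alt; apply: sm; apply: small_color ct r alt b1'.
have cols x : 1 < missing n m x (transpose c) ->
    missing n m (~~ x) (transpose c) = 0 \/ 1 < missing m n x c ->
    area m n (Some x) c + 3 <= area m n (Some (~~ x)) c.
  move=> r alt; apply: sm; rewrite -area_transpose.
  by apply: (small_color ctt r) => //; rewrite area_transpose.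
have rows1 x : n < m -> 1 < missing m n x c -> missing m n (~~ x) c <= 1 ->
    area m n (Some x) c + 3 <= area m n (Some (~~ x)) c.
  move=> nm r r'; have bn : area m n None c < n.*2 by lia.
  apply: (one_bad_row_margin n1 nm mn (tot x) bn).
  exact: small_color_one_bad_row ct m1 r r' bn.
have cols1 x : m < n -> 1 < missing n m x (transpose c) ->
    missing n m (~~ x) (transpose c) <= 1 ->
    area m n (Some x) c + 3 <= area m n (Some (~~ x)) c.
  move=> nm r r'; have bn : area m n None c < m.*2 by lia.
  have totx := tot x; rewrite addnC in mn; rewrite mulnC in totx.
  apply: (one_bad_row_margin m1 nm mn totx bn).
  rewrite -area_transpose; rewrite -area_transpose in bn.
  exact: small_color_one_bad_row ctt n1 r r' bn.
have RT := rows_None true ct m1 n1.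
have CT := rows_None true ctt n1 m1.
rewrite area_transpose in CT.
have := missing_cases b1 b2 RT CT.
case=> [[r alt]|]; first by apply: (goalP true); exact: rows.
case=> [[r alt]|]; first by apply: (goalP false); exact: rows.
case=> [[r alt]|]; first by apply: (goalP true); exact: cols.
case=> [[r alt]|]; first by apply: (goalP false); exact: cols.
case=> [[nm [r r']]|]; first by apply: (goalP true); exact: rows1.
case=> [[nm [r r']]|]; first by apply: (goalP false); exact: rows1.
case=> [[nm [r r']]|]; first by apply: (goalP true); exact: cols1.
case=> [[nm [r r']]|]; first by apply: (goalP false); exact: cols1.
move=> [mn' [r [r' [k k']]]]; right; right; split=> //.
rewrite -mn' in ct n1 b2 r r' k k' *.
apply: diamond_balanced => //; [by case|by case|].
by rewrite addn2; exact: b2.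
Qed.

(** With fewer vacancies than rows and columns, some row and some column have
    none; they are filled with a common colour, so the other colour avoids a
    row while every row contains the common one. *)
Lemma open_isoperimetry m n c :
  (forall i j, i < m -> j.+1 < n -> compat (c i j) (c i j.+1)) ->
  (forall i j, i.+1 < m -> j < n -> compat (c i j) (c i.+1 j)) ->
  1 < m -> 1 < n -> area m n None c < minn m n ->
  area m n (Some true) c + 3 <= area m n (Some false) c \/
  area m n (Some false) c + 3 <= area m n (Some true) c.
Proof.
move=> ch cv m1 n1 bmn.
have full m' n' c' : area m' n' None c' < m' ->
    exists2 i, i < m' & count_color n' None (c' i) = 0.
  move=> b'; suff : 0 < \sum_(i < m') (count_color n' None (c' i) == 0).
    move=> /(sum_bool_gt0P m' (fun i => count_color n' None (c' i) == 0)).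
    by case=> i im /eqP ci; exists i.
  suff : m' <= area m' n' None c' + \sum_(i < m') (count_color n' None (c' i) == 0).
    by case: (\sum_(i < m') _) => [|//]; lia.
  rewrite /area -big_split -[leqLHS]card_ord -sum1_card /=.
  by apply: leq_sum => i _; case: (count_color _ _ _).
have [|i0 i0m ri0] := @full m n c; first by lia.
have [|j0 j0n cj0] := @full n m (transpose c); first by rewrite area_transpose; lia.
have [x cx] : exists x, c i0 j0 = Some (~~ x).
  have := count_color0 ri0 j0n; case: (c i0 j0) => [y _|//].
  by exists (~~ y); rewrite negbK.
have rx : count_color n (Some x) (c i0) = 0.
  have [//|rx] := posnP (count_color n (Some x) (c i0)).
  have ry : 0 < count_color n (Some (~~ x)) (c i0).
    by apply/count_color_gt0P; exists j0.
  by have := open_line_None (fun j => ch i0 j i0m) rx ry; rewrite ri0.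
have colx i : i < m -> c i j0 = Some (~~ x).
  move=> im; have [rx0|kx] := posnP (count_color m (Some x) (transpose c j0)).
    have := count_color0 rx0 im; have := count_color0 cj0 im.
    by rewrite /transpose; case: (c i j0) => // [[]]; case: (x).
  have ky : 0 < count_color m (Some (~~ x)) (transpose c j0).
    by apply/count_color_gt0P; exists i0.
  have kv i' : i'.+1 < m -> compat (transpose c j0 i') (transpose c j0 i'.+1).
    by move=> im'; exact: cv.
  by have := open_line_None kv kx ky; rewrite cj0.
have layer t : t < n -> 0 < long_rows m (fun i => count_color n (Some x) (c i)) t ->
    t.+1 + long_rows m (fun i => count_color n (Some x) (c i)) t <= area m n None c.
  move=> _; apply: (@open_layer m _ (fun i => count_color n None (c i)) i0) => //.
  - move=> i im; apply: leq_trans (@count_color_step n x (c i.+1) (c i) _) _ => //.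
    by move=> j jn; rewrite compatC; exact: cv.
  - by move=> i im; apply: count_color_step => j jn; exact: cv.
  - move=> i im h; have hy : 0 < count_color n (Some (~~ x)) (c i).
      by apply/count_color_gt0P; exists j0 => //; exact: colx.
    by have := open_line_None (fun j => ch i j im) h hy.
have dn i : i < m -> count_color n (Some x) (c i) <= n.
  by move=> _; exact: count_color_le.
have hx := layer_bound dn layer; rewrite -/(area m n (Some x) c) in hx.
have tot := area_partition m n x c.
suff : area m n (Some x) c + 3 <= area m n (Some (~~ x)) c.
  by case: (x); [left | right].
move: hx tot bmn.
move: (area m n (Some x) c) (area m n (Some (~~ x)) c) (area m n None c) => a d b.
move=> hx tot bmn.
have : b.+1 * b.+1 <= m * n by apply: leq_mul; lia.
have [b0|b0] := posnP b; first by rewrite b0 in hx tot; nia.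
by case: b b0 hx tot bmn => // b _ /=; nia.
Qed.

(** * Energy landscape in terms of vacancies *)

Section Paths.
Variables (bc : boundary) (K L M : nat).
Local Notation X := (config bc K L M).
Implicit Types (s t u : X).

Definition vacancies s : nat := #|[set v | val s v == ord0]|.

Lemma energyE s : energy s = ((vacancies s)%:Z - (K * L)%:Z)%R.
Proof.
have -> : vacancies s = \sum_(v : site K L) (val s v == ord0).
  rewrite /vacancies -sum1_card big_mkcond.
  by apply: eq_bigr => v _; rewrite inE; case: (_ == _).
have tot : \sum_(v : site K L) (val s v != ord0)
    + \sum_(v : site K L) (val s v == ord0) = K * L.
  rewrite -big_split /= (eq_bigr (fun=> 1)); last first.
    by move=> v _; case: (_ == _).
  by rewrite sum1_card card_prod !card_ord mulnC.
rewrite /energy -(big_morph _ PoszD (erefl _)) -tot.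
by move: (\sum_(v : site K L) _) (\sum_(v : site K L) _) => S T; lia.
Qed.

(** Restricting moves to configurations with at most [h] vacancies turns a
    bound on the communication height into connectedness. *)
Definition low_move (h : nat) : rel X := [rel s t |
  [&& single_particle_move s t, vacancies s <= h & vacancies t <= h]].

Lemma low_move_sym h : connect_sym (low_move h).
Proof.
apply: sym_connect_sym => s t.
by rewrite /low_move /= move_sym; congr (_ && _); rewrite andbC.
Qed.

Lemma height_ge s p u : u \in s :: p -> (energy u <= height s p)%R.
Proof.
rewrite /height; elim: p => [|v p IHp].
  by rewrite inE big_nil => /eqP ->.
rewrite big_cons le_max !inE => /or3P[us|/eqP -> |up]; last first.
- by rewrite IHp ?orbT // inE up orbT.
- by rewrite lexx.
- by rewrite IHp ?orbT // inE us.
Qed.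

Lemma height_le s p (B : int) :
  (forall u, u \in s :: p -> (energy u <= B)%R) -> (height s p <= B)%R.
Proof.
rewrite /height; elim: p => [|v p IHp] h.
  by rewrite big_nil h // inE eqxx.
rewrite big_cons ge_max h ?inE ?eqxx ?orbT //= IHp // => u.
by rewrite inE => /orP[us|up]; apply: h; rewrite !inE ?us ?up ?orbT.
Qed.

Lemma comm_height_le s t h : connect (low_move h) s t -> vacancies s <= h ->
  (comm_height s t <= h%:Z - (K * L)%:Z)%R.
Proof.
case/connectP => p hp -> hs; have [_ lb] := comm_heightP s (last s p).
apply: le_trans (lb _ (ex_intro2 _ _ p _ erefl)) _.
  rewrite /is_path eqxx andbT; apply: sub_path hp => u v /and3P[uv _ _].
  exact: conn_gt0.
apply: height_le => u; rewrite energyE lerD2r lez_nat.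
elim: p s hs hp {lb} => [|v p IHp] s hs /=; first by rewrite inE => _ /eqP ->.
case/andP=> /and3P[_ _ hv] hp; rewrite inE => /orP[/eqP -> //|].
exact: IHp.
Qed.

Lemma comm_height_ge s t h :
  (forall p, is_path s t p -> exists2 u, u \in s :: p & h <= vacancies u) ->
  (h%:Z - (K * L)%:Z <= comm_height s t)%R.
Proof.
move=> H; have [[p hp ->] _] := comm_heightP s t.
have [u us hu] := H p hp; apply: le_trans (height_ge us).
by rewrite energyE lerD2r lez_nat.
Qed.

Lemma conn_move s t : (0 < conn s t)%R -> s = t \/ single_particle_move s t.
Proof.
rewrite /conn; case: eqP => [->|_]; first by left.
by rewrite /conn_off; case: ifP => [_|_]; [right | rewrite ltxx].
Qed.

(** A discrete intermediate value theorem. *)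
Lemma path_crosses (f : X -> int) (d : int) s t p :
  (forall u v, single_particle_move u v -> (f v <= f u + 1)%R) ->
  is_path s t p -> (f s <= d)%R -> (d <= f t)%R ->
  exists2 u, u \in s :: p & f u = d.
Proof.
move=> fm /andP[hp /eqP <-].
elim: p s hp => [|v p IHp] s /=.
  move=> _ fs ft; exists s; first by rewrite inE.
  by apply/eqP; rewrite eq_le fs ft.
case/andP=> /conn_move sv hp fs ft.
have [sd|sd] := eqVneq (f s) d; first by exists s => //; rewrite inE eqxx.
have fv : (f v <= d)%R by case: sv => [<- //|/fm]; lia.
by have [u up fu] := IHp v hp fv ft; exists u => //; rewrite inE up orbT.
Qed.

End Paths.

(** * The lower bound on the communication height *)

Lemma adjacent_sym bc K L (v w : site K L) : adjacent bc v w = adjacent bc w v.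
Proof.
case: bc => /=; last by rewrite !(distnC w.1) !(distnC w.2).
rewrite [w == v]eq_sym [w.1 == _]eq_sym [w.2 == _]eq_sym /cyc_adj.
congr (_ && (_ && _ || _ && _)); rewrite orbC; congr (_ || _); exact: eq_sym.
Qed.

Lemma adjacent_right bc K L (v w : site K L) :
  w.1 = v.1.+1 :> nat -> w.2 = v.2 -> adjacent bc v w.
Proof.
case: v w => j i [j' i'] /= ej ei; rewrite ei; case: bc => /=; last first.
  by rewrite ej; lia.
rewrite -pair_eqE /= eqxx andbT /cyc_adj ej addn1 eqxx /= andbT.
by apply/eqP => /(congr1 val) /=; rewrite ej; lia.
Qed.

Lemma adjacent_up bc K L (v w : site K L) :
  w.2 = v.2.+1 :> nat -> w.1 = v.1 -> adjacent bc v w.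
Proof.
case: v w => j i [j' i'] /= ei ej; rewrite ej; case: bc => /=; last first.
  by rewrite ei; lia.
rewrite -pair_eqE /= eqxx /= /cyc_adj ei addn1 addn1 eqxx /= !orbT andbT.
by apply/eqP => /(congr1 val) /=; rewrite ei; lia.
Qed.

(** The lattice is connected, in the form of an induction principle. *)
Lemma lattice_connected bc K L (P : pred (site K L)) :
  (forall v w, adjacent bc v w -> P v -> P w) -> forall v w, P v -> P w.
Proof.
move=> Padj.
have Peq v w : adjacent bc v w -> P v = P w.
  by move=> vw; apply/idP/idP; apply: Padj; rewrite // adjacent_sym.
case: K P Padj Peq => [|K] P Padj Peq; first by case=> ? [].
case: L P Padj Peq => [|L] P Padj Peq; first by case=> [[]].
suff P0 v : P v = P (ord0, ord0) by move=> v w; rewrite !P0.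
case: v => j i; have -> : P (j, i) = P (ord0, i).
  case: j => j hj; elim: j hj => [|j IHj] hj.
    by congr (P (_, _)); apply: val_inj.
  rewrite -(IHj (ltnW hj)); symmetry; apply: Peq; exact: adjacent_right.
case: i => i hi; elim: i hi => [|i IHi] hi.
  by congr (P (_, _)); apply: val_inj.
rewrite -(IHi (ltnW hi)); symmetry; apply: Peq; exact: adjacent_up.
Qed.

Section Stable.
Variables (bc : boundary) (K L M : nat).
Local Notation X := (config bc K L M).
Implicit Types (s t u : X) (m : 'I_M.+1).

Lemma mono_adm m : admissible bc ([ffun=> m] : {ffun site K L -> 'I_M.+1}).
Proof.
by apply/forallP => a; apply/forallP => b; rewrite !ffunE eqxx orbT implybT.
Qed.

Definition mono m : X := exist (fun f => admissible bc f) _ (mono_adm m).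

Lemma vacancies_mono m : m != ord0 -> vacancies (mono m) = 0.
Proof.
move=> m0; apply/eqP; rewrite cards_eq0; apply/eqP/setP => v.
by rewrite !inE ffunE (negPf m0).
Qed.

Lemma config_compat s v w : adjacent bc v w ->
  [|| val s v == ord0, val s w == ord0 | val s v == val s w].
Proof.
move=> vw; have /forallP/(_ v)/forallP/(_ w)/implyP/(_ vw) := valP s.
by rewrite muln_eq0 -orbA.
Qed.

Lemma no_vacancy_mono s : vacancies s = 0 -> forall v, s = mono (val s v).
Proof.
move=> s0; have nz v : val s v != ord0.
  move/eqP: s0; rewrite cards_eq0 => /eqP/setP/(_ v).
  by rewrite !inE => ->.
move=> v; apply/val_inj/ffunP => w; rewrite ffunE; apply/eqP.
apply: (@lattice_connected bc K L (fun w => val s w == val s v) _ v w) => //.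
move=> a b ab /eqP <-; have := config_compat s ab.
by rewrite (negPf (nz a)) (negPf (nz b)) /= eq_sym.
Qed.

Lemma stableE s : 0 < M -> (s \in stable bc K L M) = (vacancies s == 0).
Proof.
move=> M0; rewrite inE; apply/forallP/eqP => [/(_ (mono (inord 1)))|s0 t].
  rewrite !energyE lerD2r lez_nat vacancies_mono ?leqn0 => [/eqP //|].
  by rewrite -val_eqE /= inordK.
by rewrite !energyE lerD2r lez_nat s0.
Qed.

End Stable.

Section Color.
Variables (bc : boundary) (K L M : nat) (K0 : 0 < K) (L0 : 0 < L).
Local Notation X := (config bc K L M).
Implicit Types (s t u : X) (m : 'I_M.+1).

Definition color m (k : 'I_M.+1) : option bool :=
  if k == ord0 then None else Some (k == m).

Definition wrap_site (i j : nat) : site K L :=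
  (Ordinal (ltn_pmod j L0), Ordinal (ltn_pmod i K0)).

(** Rows come first in a colouring, whereas a site is a pair of a column and a
    row. *)
Definition coloring m u : nat -> nat -> option bool :=
  fun i j => color m (val u (wrap_site i j)).

Definition number m (x : option bool) u : nat :=
  \sum_(v : site K L) (color m (val u v) == x).

Lemma area_coloring m x u : area K L x (coloring m u) = number m x u.
Proof.
rewrite /number (eq_bigr (fun v => nat_of_bool (color m (val u (v.1, v.2)) == x))); last first.
  by case.
rewrite -(pair_bigA _ (fun j i => nat_of_bool (color m (val u (j, i)) == x))) /=.
rewrite exchange_big; apply: eq_bigr => i _; apply: eq_bigr => j _.
congr (nat_of_bool (color m (val u (_, _)) == x)); apply: val_inj => /=;
  by rewrite modn_small.
Qed.

Lemma vacancies_number m u : vacancies u = number m None u.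
Proof.
rewrite /vacancies -sum1_card big_mkcond; apply: eq_bigr => v _.
by rewrite inE /color; case: (val u v == ord0).
Qed.

Lemma coloring_compat m u v w : v = w \/ adjacent bc v w ->
  compat (color m (val u v)) (color m (val u w)).
Proof.
case=> [->|/(config_compat u)]; first by rewrite /compat eqxx !orbT.
rewrite /compat /color; case: (val u v == ord0) => //.
by case: (val u w == ord0) => //= /eqP ->.
Qed.

Lemma number_move m u v : single_particle_move u v ->
  ((number m (Some true) v)%:Z - (number m (Some false) v)%:Z <=
   (number m (Some true) u)%:Z - (number m (Some false) u)%:Z + 1)%R.
Proof.
case/existsP=> z /and3P[uvz zz /forallP same].
have eqo x : \sum_(w | w != z) (color m (val v w) == x)
           = \sum_(w | w != z) (color m (val u w) == x).
  by apply: eq_bigr => w wz; have /implyP/(_ wz)/eqP -> := same w.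
rewrite /number !(bigD1 z (P := xpredT)) //= !eqo.
move: (\sum_(w | _) _) (\sum_(w | _) _) => S T.
rewrite /color; move: zz uvz; case: eqP => [->|_] /=.
  by rewrite eq_sym => _ /negPf ->; case: (_ == _); lia.
move=> /eqP -> _; rewrite eqxx /=; case: (val u z == m) => /=; lia.
Qed.

End Color.

Lemma torus_coloring_config K L M (K1 : 1 < K) (L1 : 1 < L) m
    (u : config Periodic K L M) :
  torus_coloring K L (coloring (ltnW K1) (ltnW L1) m u).
Proof.
pose S := @wrap_site K L (ltnW K1) (ltnW L1).
split=> i j; rewrite /coloring.
- apply: coloring_compat; have [e|ne] := eqVneq (S i j) (S i j.+1); [by left | right].
  rewrite /adjacent ne andTb; apply/orP; left.
  by rewrite /cyc_adj /= eqxx -[j.+1]addn1 modn_mod modnDml eqxx.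
- apply: coloring_compat; have [e|ne] := eqVneq (S i j) (S i.+1 j); [by left | right].
  rewrite /adjacent ne andTb; apply/orP; right.
  by rewrite /cyc_adj /= eqxx -[i.+1]addn1 modn_mod modnDml eqxx.
- by congr (color m (val u (_, _))); apply: val_inj; rewrite /= modnDr.
- by congr (color m (val u (_, _))); apply: val_inj; rewrite /= modnDr.
Qed.

(** The parity of [d] makes the number of vacancies congruent to [Gamma]
    modulo 2, so that falling short of [Gamma] means falling short by two. *)
Lemma vacancies_barrier bc K L M (u : config bc K L M) m : 1 < K -> 1 < L ->
  (bc = Periodic -> 6 <= K + L) ->
  forall d, d = (if odd (K * L + Gamma bc K L) then 1 else 2) ->
  number m (Some true) u = number m (Some false) u + d ->
  Gamma bc K L <= vacancies u.
Proof.
move=> K1 L1 KL d hd hn.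
have K0 := ltnW K1; have L0 := ltnW L1.
have tot := area_partition K L true (coloring K0 L0 m u).
rewrite (vacancies_number m) leqNgt; apply/negP => lt.
rewrite !area_coloring /= in tot.
have lt2 : number m None u + 2 <= Gamma bc K L.
  by move: hd; case: ifP; lia.
have d12 : 0 < d <= 2 by rewrite hd; case: ifP.
case: bc u KL hd hn tot lt lt2 => u KL hd hn tot lt lt2.
  have ct := torus_coloring_config K1 L1 m u.
  have := periodic_isoperimetry ct K1 L1 (KL erefl); rewrite !area_coloring.
  move: lt2; rewrite /Gamma; case: eqP => KLe lt2.
    by move=> h; have := h ltac:(lia) (fun e => ltac:(lia)); lia.
  by move=> h; have := h ltac:(lia) (fun e => ltac:(lia)); lia.
have ch i j : i < K -> j.+1 < L ->
    compat (coloring K0 L0 m u i j) (coloring K0 L0 m u i j.+1).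
  move=> iK jL; apply: coloring_compat; right; apply: adjacent_right => //.
  by rewrite /= !modn_small //; lia.
have cv i j : i.+1 < K -> j < L ->
    compat (coloring K0 L0 m u i j) (coloring K0 L0 m u i.+1 j).
  move=> iK jL; apply: coloring_compat; right; apply: adjacent_up => //.
  by rewrite /= !modn_small //; lia.
have := open_isoperimetry ch cv K1 L1; rewrite !area_coloring.
move: lt2; rewrite /Gamma => lt2 h; have := h ltac:(lia).
by lia.
Qed.

Lemma comm_height_stable_ge bc K L M (s s' : config bc K L M) :
  1 < K -> 1 < L -> (bc = Periodic -> 6 <= K + L) -> 0 < M ->
  s \in stable bc K L M -> s' \in stable bc K L M -> s != s' ->
  ((Gamma bc K L)%:Z <= comm_height s s' - energy s)%R.
Proof.
move=> K1 L1 KL M0; rewrite !stableE // => /eqP s0 /eqP s'0 ss'.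
rewrite energyE s0 -[leLHS]addr0 -(subrr (K * L)%:Z)%R.
suff : ((Gamma bc K L)%:Z - (K * L)%:Z <= comm_height s s')%R by lia.
have K0 := ltnW K1; have L0 := ltnW L1.
pose z := wrap_site K0 L0 0 0; pose m := val s' z.
have e' := no_vacancy_mono s'0 z; have e := no_vacancy_mono s0 z.
have m0 : m != ord0.
  by apply: contra_eqN s'0 => /eqP m0; rewrite e' -/m m0 -lt0n; apply/card_gt0P; exists z; rewrite inE ffunE.
have sm : val s z != m by apply: contraNneq ss' => szm; rewrite e szm -e'.
have sz0 : val s z != ord0.
  by apply: contra_eqN s0 => /eqP k0; rewrite e k0 -lt0n; apply/card_gt0P; exists z; rewrite inE ffunE.
have nmono k x : number m x (mono bc K L k) = (color m k == x) * (K * L).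
  rewrite /number (eq_bigr (fun=> nat_of_bool (color m k == x))).
    by rewrite sum_nat_const card_prod !card_ord [L * K]mulnC mulnC.
  by move=> v _; rewrite ffunE.
apply: comm_height_ge => p hp.
(* The excess of type [m] at which the path is stopped. *)
pose d := if odd (K * L + Gamma bc K L) then 1 else 2.
have d2 : 0 < d <= 2 by rewrite /d; case: ifP.
have KL4 : 4 <= K * L by rewrite (@leq_mul 2 2).
have [|||u up fu] := @path_crosses bc K L M (fun u =>
   (number m (Some true) u)%:Z - (number m (Some false) u)%:Z)%R d%:Z s s' p _ hp.
- by move=> u v; exact: number_move.
- by rewrite e !nmono /color (negPf sz0) (negPf sm) /=; lia.
- by rewrite e' !nmono /color (negPf m0) eqxx /=; lia.
exists u => //; apply: (@vacancies_barrier _ _ _ _ u m K1 L1 KL d erefl).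
by lia.
Qed.

(** * Sweeping one particle type over the lattice *)

Section Sweep.
Variables (bc : boundary) (K L M : nat).
Local Notation X := (config bc K L M).
Local Notation V := (site K L).
Implicit Types (s t u : X) (m : 'I_M.+1) (A B : {set V}).

(** The outer vertex boundary. *)
Definition frontier A : {set V} :=
  [set w | (w \notin A) && [exists v, (v \in A) && adjacent bc v w]].

Definition erased s t : Prop := forall v, val t v = val s v \/ val t v = ord0.

Lemma erased_vacancies s t : erased s t -> vacancies s <= vacancies t.
Proof.
move=> st; apply: subset_leq_card; apply/fintype.subsetP => v; rewrite !inE => /eqP sv.
by case: (st v) => ->; rewrite ?sv.
Qed.

(** Erasing particles one by one only adds vacancies, so the last configuration
    has the most. *)
Lemma erased_connect s t h : erased s t -> vacancies t <= h ->
  connect (low_move h) s t.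
Proof.
have [n] := ubnP #|[set v | val s v != val t v]|; elim: n s => // n IHn s ltn st th.
have [v /= nv|same] := pickP [pred v | val s v != val t v]; last first.
  rewrite (_ : s = t) //; apply/val_inj/ffunP => v.
  by have /= /negbFE/eqP := same v.
have tv : val t v = ord0 by case: (st v) nv => [-> /eqP|//].
have rt : erased (remove_config s v) t.
  by move=> w; rewrite /= ffunE; case: (w =P v) => [->|_]; [right | exact: st].
apply: connect_trans (IHn (remove_config s v) _ rt th).
  apply: connect1; apply/and3P; split.
  - apply/existsP; exists v; rewrite /= ffunE eqxx orbT -tv nv /=.
    by apply/forallP => w; apply/implyP => /negPf wv; rewrite ffunE wv.
  - exact: leq_trans (erased_vacancies st) th.
  - exact: leq_trans (erased_vacancies rt) th.
rewrite ltnS in ltn; apply: leq_trans ltn; apply: proper_card.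
apply/fintype.properP; split; last first.
  by exists v; rewrite !inE //= ffunE eqxx tv eqxx.
apply/fintype.subsetP => w; rewrite !inE /= ffunE.
by case: (w =P v) => [->|//]; rewrite tv eqxx.
Qed.

(** The sites of [A] are filled, and those of [B] and its frontier are
    cleared of the particles of other types.  With [B = A] this is a stage of the
    sweep; with [B] the next filled set it is the passage between two stages. *)
Definition swept_fun s m A B : {ffun V -> 'I_M.+1} :=
  [ffun w => if w \in A then m
             else if (w \in B :|: frontier B) && (val s w != m) then ord0
             else val s w].

Lemma swept_adm s m A B : A \subset B -> admissible bc (swept_fun s m A B).
Proof.
move=> AB; suff H v w : adjacent bc v w ->
    [|| swept_fun s m A B v == ord0, swept_fun s m A B w == ord0
      | swept_fun s m A B v == swept_fun s m A B w].
  apply/forallP => v; apply/forallP => w; apply/implyP => /H.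
  by rewrite muln_eq0 -orbA.
have AfB a b : a \in A -> adjacent bc a b -> b \in B :|: frontier B.
  move=> aA ab; rewrite !inE; case: (boolP (b \in B)) => //= _.
  by apply/existsP; exists a; rewrite ab (fintype.subsetP AB).
move=> vw; rewrite /swept_fun !ffunE.
case: (boolP (v \in A)) => vA; case: (boolP (w \in A)) => wA.
- by rewrite eqxx !orbT.
- by rewrite (AfB v w) //=; case: (val s w =P m) => [->|_]; rewrite eqxx !orbT.
- rewrite (AfB w v) //= 1?adjacent_sym //.
  by case: (val s v =P m) => [->|_]; rewrite eqxx ?orbT.
- case: ifP => _; first by rewrite eqxx.
  case: ifP => _; first by rewrite eqxx orbT.
  exact: config_compat.
Qed.

(** The default value of [insubd] is never reached when [A] is a subset of
    [B], by [swept_adm]. *)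
Definition swept s m A B : X := insubd s (swept_fun s m A B).

Lemma val_swept s m A B : A \subset B -> val (swept s m A B) = swept_fun s m A B.
Proof. by move=> AB; rewrite /swept insubdK //; exact: swept_adm. Qed.

Lemma frontier0 : frontier set0 = set0.
Proof.
apply/setP => w; rewrite !inE /=; apply/existsP => -[v].
by rewrite inE.
Qed.

Lemma closureS A B : A \subset B -> A :|: frontier A \subset B :|: frontier B.
Proof.
move=> AB; apply/fintype.subsetP => w; rewrite !inE.
case: (boolP (w \in B)) => //= wB /orP[/(fintype.subsetP AB)|]; first by rewrite (negPf wB).
case/andP=> _ /existsP[v /andP[vA vw]]; apply/existsP; exists v.
by rewrite vw (fintype.subsetP AB).
Qed.

Definition sweep_plan (g N : nat) (A : nat -> {set V}) : Prop :=
  [/\ A 0 = set0, A N = [set: V], forall n, A n \subset A n.+1,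
      forall n, #|A n.+1| <= #|A n|.+1 & forall n, #|frontier (A n)| <= g].

(** Two consecutive stages have the common erasure in which the site about to
    be filled and the new frontier are cleared. *)
Lemma sweep_connect g N (A : nat -> {set V}) s m h : sweep_plan g N A ->
  (forall n, n < N -> vacancies (swept s m (A n) (A n.+1)) <= h) ->
  connect (low_move h) s (mono bc K L m).
Proof.
move=> [A0 AN Amono _ _] hmid.
have erase1 n : erased (swept s m (A n) (A n)) (swept s m (A n) (A n.+1)).
  move=> w; rewrite !val_swept // /swept_fun !ffunE.
  case: (boolP (w \in A n)) => [_|wA]; first by left.
  case: (boolP (val s w != m)) => [swm|_]; last by rewrite !andbF; left.
  rewrite !andbT; case: (boolP (w \in A n.+1 :|: _)) => [_|w']; first by right.
  by left; case: ifP => // /(fintype.subsetP (closureS (Amono n))); rewrite (negPf w').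
have erase2 n : erased (swept s m (A n.+1) (A n.+1)) (swept s m (A n) (A n.+1)).
  move=> w; rewrite !val_swept // /swept_fun !ffunE.
  case: (boolP (w \in A n)) => [/(fintype.subsetP (Amono n)) ->|wA]; first by left.
  case: (boolP (w \in A n.+1)) => [wA'|_]; last by left.
  by rewrite inE wA' /=; case: (val s w =P m); [left | right].
have -> : s = swept s m (A 0) (A 0).
  apply/val_inj/ffunP => w; rewrite val_swept // /swept_fun A0 ffunE.
  by rewrite frontier0 setU0 !inE.
have -> : mono bc K L m = swept s m (A N) (A N).
  by apply/val_inj/ffunP => w; rewrite val_swept // /swept_fun AN !ffunE inE.
elim: N {AN} hmid => [|N IHN] hmid; first exact: connect0.
apply: connect_trans (IHN (fun n nN => hmid n (ltnW nN))) _.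
apply: connect_trans (erased_connect (erase1 N) (hmid N (ltnSn N))) _.
by rewrite low_move_sym; apply: erased_connect (erase2 N) (hmid N (ltnSn N)).
Qed.

(** The particles erased at the passage from [A] to [B]. *)
Definition foreign s m A B : {set V} :=
  [set w in (B :|: frontier B) :\: A | (val s w != ord0) && (val s w != m)].

Lemma swept_vacancies s m A B : m != ord0 -> A \subset B ->
  vacancies (swept s m A B) + #|[set w in A | val s w == ord0]|
    <= vacancies s + #|foreign s m A B|.
Proof.
move=> m0 AB; rewrite /vacancies -[in leqRHS](cardsID A).
rewrite (_ : _ :&: A = [set w in A | val s w == ord0]); last first.
  by apply/setP => w; rewrite !inE andbC.
rewrite -addnA addnC leq_add2l; apply: leq_trans (leq_card_setU _ _).
apply: subset_leq_card; apply/fintype.subsetP => w.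
rewrite !inE val_swept // /swept_fun ffunE.
case: (boolP (w \in A)) => wA /=; first by rewrite (negPf m0).
case: (boolP (val s w == ord0)) => sw //=.
by rewrite inE inE; case: ifP => // _; rewrite (negPf sw).
Qed.

Lemma foreign_le g N (A : nat -> {set V}) s m n : sweep_plan g N A ->
  #|foreign s m (A n) (A n.+1)| <= #|(A n.+1 :|: frontier (A n.+1)) :\: A n| <= g.+1.
Proof.
move=> [_ _ Amono Astep Ag]; apply/andP; split.
  by apply: subset_leq_card; apply/fintype.subsetP => w; rewrite inE => /andP[].
rewrite setDUl; apply: leq_trans (leq_card_setU _ _) _.
rewrite -[g.+1]add1n; apply: leq_add.
  by rewrite cardsD (setIidPr (Amono n)) leq_subLR addn1.
exact: leq_trans (subset_leq_card (subsetDl _ _)) (Ag _).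
Qed.

Lemma sweep_vacancies g N (A : nat -> {set V}) s m n : sweep_plan g N A -> m != ord0 ->
  vacancies (swept s m (A n) (A n.+1)) <= vacancies s + g.+1.
Proof.
move=> plan m0; have [_ _ Amono _ _] := plan.
have := swept_vacancies s m0 (Amono n).
by have /andP[] := foreign_le s m n plan; lia.
Qed.

Lemma sweep_first g N (A : nat -> {set V}) (v0 : V) : sweep_plan g N A ->
  exists v1, forall n, A n = set0 \/ v1 \in A n.
Proof.
move=> [A0 AN Amono Astep _].
have ex : exists n, A n != set0.
  by exists N; rewrite AN; apply/set0Pn; exists v0; rewrite inE.
case: (ex_minnP ex) => [[|n]]; first by rewrite A0 eqxx.
move=> /set0Pn[v vA] minA; exists v => k.
have Ale i j : i <= j -> A i \subset A j.
  elim: j => [|j IHj]; first by rewrite leqn0 => /eqP ->.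
  rewrite leq_eqVlt => /orP[/eqP -> //|ij].
  exact: fintype.subset_trans (IHj ij) (Amono j).
have [kn|nk] := ltnP k n.+1; last by right; exact: (fintype.subsetP (Ale _ _ nk)).
by left; apply/eqP; apply: contraTT kn => /minA; rewrite -leqNgt.
Qed.

(** In case of equality every site around the filled part and the site about
    to be filled hold a foreign particle, and the filled part [A n] had no
    vacancy in [s].  Then the sites of [A n] of type [m], which include [v1],
    have no neighbour outside of their set, which contradicts connectedness. *)
Lemma sweep_vacancies_strict g N (A : nat -> {set V}) s m v1 n : sweep_plan g N A -> m != ord0 ->
  (forall n, A n = set0 \/ v1 \in A n) -> val s v1 = ord0 \/ val s v1 = m ->
  vacancies (swept s m (A n) (A n.+1)) <= vacancies s + g.
Proof.
move=> plan m0 first sv1; have [_ _ Amono Astep _] := plan.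
have le1 := swept_vacancies s m0 (Amono n).
have /andP[le2 le3] := foreign_le s m n plan.
rewrite leqNgt; apply/negP => lt.
(* Equality forces the count of vacancies and the count of erased particles to be extremal. *)
have Z0 : [set w in A n | val s w == ord0] = set0.
  by apply/eqP; rewrite -cards_eq0; lia.
have nz w : w \in A n -> val s w != ord0.
  by move=> wA; move/setP/(_ w): Z0; rewrite !inE wA /= => ->.
have Yall : foreign s m (A n) (A n.+1) = (A n.+1 :|: frontier (A n.+1)) :\: A n.
  apply/eqP; rewrite eqEcard; apply/andP; split; last by lia.
  by apply/fintype.subsetP => w; rewrite inE => /andP[].
have all w : w \in A n.+1 :|: frontier (A n.+1) -> w \notin A n ->
    (val s w != ord0) && (val s w != m).
  move=> wA wnA; have : w \in foreign s m (A n) (A n.+1) by rewrite Yall inE wnA.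
  by rewrite inE => /andP[].
have grow : exists w, (w \in A n.+1) && (w \notin A n).
  apply/existsP; apply: contraT => /existsPn same.
  have AA : A n.+1 = A n.
    apply/eqP; rewrite eqEsubset Amono andbT; apply/fintype.subsetP => w wA.
    by have := same w; rewrite wA /= negbK.
  have [_ _ _ _ Ag] := plan.
  have : #|foreign s m (A n) (A n.+1)| <= g.
    rewrite Yall AA setDUl setDv set0U.
    exact: leq_trans (subset_leq_card (subsetDl _ _)) (Ag _).
  by lia.
case: grow => w0 /andP[w0A' w0A].
case: (first n) => [A0|v1A].
  case: (first n.+1) => [A1|v1A]; first by rewrite A1 inE in w0A'.
  have := all v1; rewrite A0 !inE v1A => /(_ isT isT).
  by case: sv1 => ->; rewrite eqxx ?andbF.
have sm : val s v1 = m by case: sv1 => // sv; have := nz v1 v1A; rewrite sv eqxx.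
suff : val s w0 == m.
  by have := all w0; rewrite inE w0A' => /(_ isT w0A) /andP[_ /negPf ->].
suff : (w0 \in A n) && (val s w0 == m) by case/andP.
apply: (@lattice_connected bc K L (fun w => (w \in A n) && (val s w == m)) _ v1).
  move=> v w vw /andP[vA /eqP sv].
  have cw := config_compat s vw; rewrite sv (negPf m0) /= [m == _]eq_sym in cw.
  have [wA|wA] := boolP (w \in A n).
    by rewrite (negPf (nz w wA)) in cw.
  have /(all w) : w \in A n.+1 :|: frontier (A n.+1).
    apply: (fintype.subsetP (closureS (Amono n))); rewrite !inE (negPf wA) /=.
    by apply/existsP; exists v; rewrite vA.
  by move=> /(_ wA) /andP[/negPf e1 /negPf e2]; rewrite e1 e2 in cw.
by rewrite v1A sm eqxx.
Qed.

Lemma sweep_comm_height g N (A : nat -> {set V}) s m : sweep_plan g N A -> m != ord0 ->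
  (comm_height s (mono bc K L m) <= energy s + g.+1%:Z)%R.
Proof.
move=> plan m0.
have := @comm_height_le bc K L M s (mono bc K L m) (vacancies s + g.+1).
rewrite energyE => h; apply: le_trans (h _ _) _; first last.
- by lia.
- by lia.
by apply: (sweep_connect plan) => n _; exact: sweep_vacancies plan m0.
Qed.

Lemma sweep_comm_height_stable g N (A : nat -> {set V}) s (v0 : V) : 0 < M -> sweep_plan g N A ->
  (comm_height_set [set s]%SET (stable bc K L M) <= energy s + g%:Z)%R.
Proof.
move=> M0 plan; have [v1 first] := sweep_first v0 plan.
have [m m0 sv1] : exists2 m : 'I_M.+1, m != ord0 & val s v1 = ord0 \/ val s v1 = m.
  have [sv|sv] := eqVneq (val s v1) ord0; last by exists (val s v1) => //; right.
  by exists (inord 1); [rewrite -val_eqE /= inordK | left].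
have ms : mono bc K L m \in stable bc K L M by rewrite stableE // vacancies_mono.
have [_ lb] := comm_height_setP (set11 s) ms.
apply: le_trans (lb _ _) _.
  by exists s, (mono bc K L m); rewrite set11.
have := @comm_height_le bc K L M s (mono bc K L m) (vacancies s + g).
rewrite energyE => h; apply: le_trans (h _ _) _; first last.
- by lia.
- by lia.
by apply: (sweep_connect plan) => n _; exact: sweep_vacancies_strict plan m0 first sv1.
Qed.

End Sweep.

(** * Zigzag diamonds on the square torus *)

(** The enumeration [0, 2, 4, ..., 3, 1] of a cycle: the cells of rank below
    any bound form an arc around the cell 0, which grows alternately on both
    sides. *)
Definition zigzag (K x : nat) : nat :=
  if x.*2 < K then x.*2 else ((K - x).*2).-1.

Definition cnext (K y : nat) : nat := if y.+1 == K then 0 else y.+1.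
Definition cprev (K y : nat) : nat := if y == 0 then K.-1 else y.-1.

(** The number of filled cells in row [y] when the cells with
    [zigzag x + zigzag y < s] are filled, and those with equality in the rows
    before [i]. *)
Definition width (K s i y : nat) : nat := minn K (s + (y < i) - zigzag K y).

(** The filled cells of each row form an initial segment of the zigzag order.
    The cells of row [y] that are filled or adjacent to a filled one then lie in
    the initial segment whose length is the largest of the widths of the adjacent
    rows and of the width of the row itself increased by two. *)
Definition overhang (K s i y : nat) : nat :=
  maxn (maxn (width K s i (cprev K y)) (width K s i (cnext K y)))
    (if 0 < width K s i y then minn K (width K s i y + 2) else 0)
  - width K s i y.

Lemma zigzag_surj K q : q < K -> exists2 y, y < K & zigzag K y = q.
Proof.
move=> qK; rewrite /zigzag; case oq: (odd q).
  by exists (K - (q./2).+1); [lia | case: ltnP; lia].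
by exists (q./2); [lia | case: ltnP; lia].
Qed.

Lemma zigzag_inj K x y : x < K -> y < K -> zigzag K x = zigzag K y -> x = y.
Proof.
by rewrite /zigzag => xK yK; case: (ltnP x.*2 K) => ?; case: (ltnP y.*2 K) => ?; lia.
Qed.

Lemma zigzag0 K : 0 < K -> zigzag K 0 = 0.
Proof. by rewrite /zigzag => ->. Qed.

Lemma zigzag_lt K x : x < K -> zigzag K x < K.
Proof. by rewrite /zigzag => xK; case: ifP => ?; lia. Qed.

Definition cnear (K y y' : nat) : Prop :=
  [\/ y' = y.+1, y = y'.+1, y = 0 /\ y' = K.-1 | y' = 0 /\ y = K.-1].

Lemma minn_le_add K a b k : a <= b + k -> minn K a <= minn K b + k.
Proof. by lia. Qed.

Lemma width_cnear K s i y y' : 2 < K -> y < K -> y' < K -> i < K -> cnear K y y' ->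
  width K s i y' <= width K s i y + (2 + [&& y == i, 0 < i, i.*2 < K & i.*2 <= s]).
Proof.
move=> K3 yK y'K iK near; apply: minn_le_add; move: near.
rewrite /zigzag; case=> [e|e|[e e']|[e e']];
  case: (y =P i) => ?; case: (ltnP y i) => ?; case: (ltnP y' i) => ?;
  case: (ltnP y.*2 K) => ?; case: (ltnP y'.*2 K) => ?; lia.
Qed.

Lemma cprev_cnear K y : 2 < K -> y < K -> cprev K y < K /\ cnear K y (cprev K y).
Proof.
rewrite /cprev => K3 yK; case: eqP => [->|y0]; first by split; [lia | apply: Or43].
by split; [lia | apply: Or42; lia].
Qed.

Lemma cnext_cnear K y : 2 < K -> y < K -> cnext K y < K /\ cnear K y (cnext K y).
Proof.
rewrite /cnext => K3 yK; case: eqP => [e|y0]; first by split; [lia | apply: Or44; lia].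
by split; [lia | apply: Or41].
Qed.

Lemma overhang_le_of K s i y B : 2 < K -> y < K ->
  (forall y', y' < K -> cnear K y y' -> width K s i y' <= width K s i y + B) ->
  (0 < width K s i y -> minn K (width K s i y + 2) <= width K s i y + B) ->
  overhang K s i y <= B.
Proof.
move=> K3 yK near self; rewrite /overhang leq_subLR !geq_max.
have [p1 p2] := cprev_cnear K3 yK; have [n1 n2] := cnext_cnear K3 yK.
by rewrite !near //=; case: posnP => // /self.
Qed.

(** Consecutive rows differ in width by at most two, apart from the jump
    at the row [i] where the next cell is to be added. *)
Lemma overhang_le K s i y : 2 < K -> y < K -> i < K ->
  overhang K s i y <= 2 + [&& y == i, 0 < i, i.*2 < K & i.*2 <= s].
Proof.
move=> K3 yK iK; apply: overhang_le_of => // [y' y'K near|_]; last by lia.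
exact: width_cnear.
Qed.

(** The row of rank [s + 2] lies just outside of the diamond, and loses what
    the row [i] may have in excess. *)
Lemma overhang_beyond K s i d : 2 < K -> d < K -> i < K -> zigzag K d = s + 2 ->
  overhang K s i d + [&& 0 < i, i.*2 < K & i.*2 <= s] <= 1.
Proof.
move=> K3 dK iK zd; rewrite addnC -leq_subRL; last by lia.
have wd : width K s i d = 0 by rewrite /width zd; lia.
apply: overhang_le_of => // [y' y'K near|]; last by rewrite wd.
rewrite wd /width; apply: leq_trans (geq_minr _ _) _.
move: zd near; rewrite /zigzag; case=> + [e|e|[e e']|[e e']];
  case: (ltnP y' i) => ?;
  case: (ltnP d.*2 K) => ?; case: (ltnP y'.*2 K) => ?; lia.
Qed.

(** The saving of [overhang_beyond], now in the last row, which is the only one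
    that the diamond has not reached. *)
Lemma overhang_last K s i d : 2 < K -> d < K -> i < K -> zigzag K d = K.-1 ->
  s + 2 = K -> [|| i == 0 | [&& 0 < i, i.*2 < K & i.*2 <= s]] ->
  overhang K s i d <= 1.
Proof.
move=> K3 dK iK zd sK hi.
have wd : width K s i d = 0 by rewrite /width zd; lia.
apply: overhang_le_of => // [y' y'K near|]; last by rewrite wd.
rewrite wd /width; apply: leq_trans (geq_minr _ _) _.
move: zd near; rewrite /zigzag; case=> + [e|e|[e e']|[e e']];
  case: (ltnP y' i) => ?;
  case: (ltnP d.*2 K) => ?; case: (ltnP y'.*2 K) => ?; lia.
Qed.

(** Once no row is left outside of the diamond, the savings come from its
    central row. *)
Lemma overhang_first K s i : 2 < K -> i < K -> K <= s + (0 < i) ->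
  overhang K s i 0 = 0.
Proof.
move=> K3 iK sK; have w0 : width K s i 0 = K by rewrite /width zigzag0; lia.
apply/eqP; rewrite -leqn0; apply: overhang_le_of => //; first by lia.
  by move=> y' _ _; rewrite w0 addn0 geq_minl.
by move=> _; rewrite w0 addn0 geq_minl.
Qed.

Lemma overhang_first1 K s i : 2 < K -> i < K -> K <= s + (0 < i) + 1 ->
  overhang K s i 0 <= 1.
Proof.
move=> K3 iK sK; have w0 : K <= width K s i 0 + 1 by rewrite /width zigzag0; lia.
apply: overhang_le_of => //; first by lia.
  by move=> y' _ _; apply: leq_trans w0; exact: geq_minl.
by move=> _; apply: leq_trans w0; exact: geq_minl.
Qed.

Lemma sum_pred1 K d : d < K -> \sum_(y < K) (nat_of_ord y == d) = 1.
Proof.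
move=> dK; rewrite (bigD1 (Ordinal dK)) //= eqxx big1 // => y.
by rewrite -val_eqE /= => /negPf ->.
Qed.

(** Each row has an overhang of at most two, except that the row [i] may have
    one unit more.  In each case one or two other rows make up for this excess
    and for the unit that remains to be saved. *)
Lemma overhang_sum K s i : 2 < K -> i < K -> \sum_(y < K) overhang K s i y < K.*2.
Proof.
move=> K3 iK.
have one d : d < K -> overhang K s i d <= 1 ->
    ~~ [&& 0 < i, i.*2 < K & i.*2 <= s] -> \sum_(y < K) overhang K s i y < K.*2.
  move=> dK od nT.
  suff : \sum_(y < K) overhang K s i y + \sum_(y < K) (nat_of_ord y == d)
      <= \sum_(y < K) 2.
    by rewrite sum_pred1 // sum_nat_const card_ord; lia.
  rewrite -big_split /=; apply: leq_sum => y _.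
  have := overhang_le s K3 (ltn_ord y) iK; rewrite (negPf nT) andbF.
  by case: eqP => [->|_]; lia.
have two d1 d2 : d1 < K -> d2 < K -> d1 != i -> d2 != i ->
    overhang K s i d1 + (1 + (d1 == d2)) <= 2 ->
    overhang K s i d2 + (1 + (d1 == d2)) <= 2 ->
    \sum_(y < K) overhang K s i y < K.*2.
  move=> d1K d2K d1i d2i o1 o2.
  suff : \sum_(y < K) overhang K s i y
      + (\sum_(y < K) (nat_of_ord y == d1) + \sum_(y < K) (nat_of_ord y == d2))
      <= \sum_(y < K) 2 + \sum_(y < K) (nat_of_ord y == i).
    by rewrite !sum_pred1 // sum_nat_const card_ord; lia.
  rewrite -!big_split /=; apply: leq_sum => y _.
  have := overhang_le s K3 (ltn_ord y) iK.
  case: (nat_of_ord y =P d1) => [->|_].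
    by rewrite (negPf d1i); case: eqP o1 => _; lia.
  case: (nat_of_ord y =P d2) => [->|_]; first by rewrite (negPf d2i); lia.
  by case: (nat_of_ord y =P i) => _; lia.
have [T|nT] := boolP [&& 0 < i, i.*2 < K & i.*2 <= s].
  have [i0 iK2 is2] := and3P T.
  have [sK|sK] := ltnP (s + 2) K.
    have [d dK zd] := zigzag_surj sK.
    have di : d != i.
      by apply: contra_eqN zd => /eqP ->; rewrite /zigzag iK2; lia.
    have := overhang_beyond K3 dK iK zd; rewrite T => od.
    by apply: (two d d); rewrite ?eqxx; lia.
  have [sK'|sK'] := eqVneq (s + 2) K.
    have [d dK zd] : exists2 d, d < K & zigzag K d = K.-1 by apply: zigzag_surj; lia.
    have di : d != i.
      by apply: contra_eqN zd => /eqP ->; rewrite /zigzag iK2; lia.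
    have d0 : 0 != d.
      by apply: contra_eqN zd => /eqP <-; rewrite zigzag0; lia.
    have := overhang_last K3 dK iK zd sK'; rewrite T orbT => /(_ isT) od.
    have o0 : overhang K s i 0 <= 1 by apply: overhang_first1 => //; lia.
    by apply: (two 0 d); rewrite ?(negPf d0); lia.
  have o0 : overhang K s i 0 = 0 by apply: overhang_first => //; lia.
  by apply: (two 0 0); rewrite ?eqxx ?o0; lia.
have [sK|sK] := ltnP (s + 2) K.
  have [d dK zd] := zigzag_surj sK.
  by apply: (one d dK) => //; have := overhang_beyond K3 dK iK zd; lia.
have [i0|i0] := posnP i; last first.
  by apply: (one 0) => //; [lia | apply: overhang_first1 => //; lia].
have [sK'|sK'] := eqVneq (s + 2) K.
  have [d dK zd] : exists2 d, d < K & zigzag K d = K.-1 by apply: zigzag_surj; lia.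
  by apply: (one d dK) => //; apply: (overhang_last K3 dK iK zd sK'); rewrite i0.
by apply: (one 0) => //; [lia | apply: overhang_first1 => //; lia].
Qed.

(** * Sweeps with a small frontier *)

Lemma card_window (T : finType) (f : T -> nat) (P : {pred T}) a b : injective f ->
  (forall v, v \in P -> a <= f v < b) -> #|P| <= b - a.
Proof.
move=> f_inj Pab; rewrite cardE -(size_map f) -(size_iota a (b - a)).
apply: uniq_leq_size; first by rewrite map_inj_uniq ?enum_uniq.
move=> k /mapP[v]; rewrite mem_enum => /Pab vab ->.
by rewrite mem_iota; lia.
Qed.

Lemma frontierP bc K L (A : {set site K L}) w : w \in frontier bc A ->
  w \notin A /\ exists2 v, v \in A & adjacent bc v w.
Proof. by rewrite inE => /andP[wA /existsP[v /andP[vA vw]]]; split=> //; exists v. Qed.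

Definition near (bc : boundary) (n a b : nat) : Prop :=
  match bc with Open => b = a.+1 \/ a = b.+1 | Periodic => cnear n a b end.

Lemma cyc_adj_cnear n a b : a < n -> b < n -> cyc_adj n a b -> cnear n a b.
Proof.
rewrite /cyc_adj /cnear !addn1 => an bn.
have [an1|an1] := ltnP a.+1 n; have [bn1|bn1] := ltnP b.+1 n.
- by rewrite !modn_small // => /orP[/eqP ->|/eqP <-]; [apply: Or41|apply: Or42].
- have -> : b.+1 = n by lia.
  rewrite modnn !modn_small // => /orP[/eqP ->|/eqP a0]; [by apply: Or41|].
  by apply: Or43; lia.
- have -> : a.+1 = n by lia.
  rewrite modnn !modn_small // => /orP[/eqP b0|/eqP <-]; [|by apply: Or42].
  by apply: Or44; lia.
- have -> : a.+1 = n by lia.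
  have -> : b.+1 = n by lia.
  by rewrite modnn !modn_small // => /orP[/eqP b0|/eqP a0]; [apply: Or44|apply: Or43]; lia.
Qed.

Lemma adjacent_near bc K L (v w : site K L) : adjacent bc v w ->
  (v.2 = w.2 /\ near bc L v.1 w.1) \/ (v.1 = w.1 /\ near bc K v.2 w.2).
Proof.
case: v w => j i [j' i'] /=; case: bc => /=.
  case/andP=> _ /orP[/andP[/eqP -> h]|/andP[/eqP -> h]]; [left | right];
    by split=> //; exact: cyc_adj_cnear h.
move=> h; have [ii|ii] := eqVneq (i : nat) i'.
  by left; split; [exact: val_inj | lia].
by right; split; [apply: val_inj => /= | ]; lia.
Qed.

Section IndexPlan.
Variables (bc : boundary) (K L : nat).
Local Notation V := (site K L).

Lemma index_plan (f : V -> nat) g N : injective f -> (forall v, f v < N) ->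
  (forall n, #|frontier bc [set v | f v < n]| <= g) ->
  sweep_plan bc g N (fun n => [set v | f v < n]).
Proof.
move=> f_inj fN hg; split=> [||n|n|//].
- by apply/setP => v; rewrite !inE.
- by apply/setP => v; rewrite !inE fN.
- by apply/fintype.subsetP => v; rewrite !inE; lia.
rewrite -(cardsID [set v | f v < n]) -[leqRHS]addn1; apply: leq_add.
  by apply: subset_leq_card; exact: subsetIr.
rewrite -[leqRHS](subSnn n); apply: card_window f_inj _ => v.
by rewrite !inE; lia.
Qed.

(** When adjacent sites differ in index by at most [l], up to wrapping around, the
    frontier of an initial segment lies in the next [l] indices and, on a torus,
    in the last [l] ones. *)
Lemma window_plan (f : V -> nat) N l : injective f -> (forall v, f v < N) ->
  (forall v w, adjacent bc v w -> f w < f v + l.+1 \/ (bc = Periodic /\ N - l <= f w)) ->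
  sweep_plan bc (if bc is Periodic then l.*2 else l) N (fun n => [set v | f v < n]).
Proof.
move=> f_inj fN adj; apply: index_plan => // n.
pose W := [set w : V | n <= f w < n + l].
pose W' := if bc is Periodic then [set w : V | N - l <= f w < N] else set0.
have sub : frontier bc [set v | f v < n] \subset W :|: W'.
  apply/fintype.subsetP => w; rewrite !inE -leqNgt => /andP[nw /existsP[v]].
  rewrite inE => /andP[vn vw]; rewrite nw /=.
  have [lt|[e le]] := adj v w vw; first by rewrite (_ : f w < n + l) //; lia.
  by rewrite /W' e inE le fN orbT.
apply: leq_trans (subset_leq_card sub) _; apply: leq_trans (leq_card_setU _ _) _.
have cW : #|W| <= l.
  by rewrite -[leqRHS](addKn n); apply: card_window f_inj _ => v; rewrite inE.
have cW' : #|W'| <= if bc is Periodic then l else 0.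
  rewrite /W'; case: (bc); last by rewrite cards0.
  have : #|[set w : V | N - l <= f w < N]| <= N - (N - l).
    by apply: card_window f_inj _ => v; rewrite inE.
  by lia.
by move: cW cW'; case: (bc); lia.
Qed.

Lemma digits_inj n a b a' b' : b < n -> b' < n ->
  a * n + b = a' * n + b' -> a = a' /\ b = b'.
Proof.
move=> bn b'n e; have n0 : 0 < n by lia.
have e1 := congr1 (divn^~ n) e; have e2 := congr1 (modn^~ n) e.
by move: e1 e2; rewrite !divnMDl // !divn_small // !addn0 !modnMDl !modn_small.
Qed.

Lemma digits_lt m n a b : a < m -> b < n -> a * n + b < m * n.
Proof.
move=> am bn; apply: leq_trans (_ : a.+1 * n <= _); first by rewrite mulSn; lia.
by rewrite leq_mul2r am orbT.
Qed.

Lemma near_digits m n a a' b : near bc m a a' -> b < n ->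
  a' * n + b < a * n + b + n.+1 \/ (bc = Periodic /\ m * n - n <= a' * n + b).
Proof.
rewrite /near; case: bc => h bn; last by left; case: h => ->; rewrite mulSn; lia.
case: h => [->|->|[_ ->]|[-> _]]; last by left; lia.
- by left; rewrite mulSn; lia.
- by left; rewrite mulSn; lia.
- by right; split=> //; rewrite -subn1 mulnBl mul1n; lia.
Qed.

Lemma row_plan : exists (A : nat -> {set V}) N,
  sweep_plan bc (if bc is Periodic then L.*2 else L) N A.
Proof.
exists (fun n => [set v : V | v.2 * L + v.1 < n]), (K * L); apply: window_plan.
- case=> j i [j' i'] /= /digits_inj[] // ei ej.
  by congr (_, _); apply: val_inj.
- by move=> v; apply: digits_lt.
- move=> v w /adjacent_near[[-> _]|[-> h]]; last exact: near_digits h (ltn_ord _).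
  by left; have := ltn_ord w.1; lia.
Qed.

Lemma column_plan : exists (A : nat -> {set V}) N,
  sweep_plan bc (if bc is Periodic then K.*2 else K) N A.
Proof.
exists (fun n => [set v : V | v.1 * K + v.2 < n]), (L * K); apply: window_plan.
- case=> j i [j' i'] /= /digits_inj[] // ej ei.
  by congr (_, _); apply: val_inj.
- by move=> v; apply: digits_lt.
- move=> v w /adjacent_near[[-> h]|[-> _]]; first exact: near_digits h (ltn_ord _).
  by left; have := ltn_ord w.2; lia.
Qed.

End IndexPlan.

Lemma cnear_sym K a b : cnear K a b -> cnear K b a.
Proof.
by case=> h; [apply: Or42 | apply: Or41 | apply: Or44 | apply: Or43].
Qed.

Lemma cnear_zigzag K a b : a < K -> b < K -> cnear K a b ->
  zigzag K b <= (zigzag K a).+2.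
Proof.
move=> aK bK; rewrite /zigzag; case=> [e|e|[e e']|[e e']];
  case: (ltnP a.*2 K) => ?; case: (ltnP b.*2 K) => ?; lia.
Qed.

Lemma cnear_cases K a b : a < K -> b < K -> cnear K a b -> b = cprev K a \/ b = cnext K a.
Proof.
rewrite /cprev /cnext => aK bK.
case=> [e|e|[e e']|[e e']].
- by right; case: eqP; lia.
- by left; case: eqP; lia.
- by left; case: eqP; lia.
- by right; case: eqP; lia.
Qed.

(** Rows one after the other would have a frontier of [2 K] sites.  Here the
    sites are ordered by the sum of their zigzag ranks, so that diamonds are
    filled, and by row for equal sums. *)
Lemma square_plan K : 2 < K -> exists A N, @sweep_plan Periodic K K (K.*2.-1) N A.
Proof.
move=> K3; pose z (x : 'I_K) := zigzag K x.
have K0 : 0 < K by lia.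
have zK (x : 'I_K) : z x < K by exact: zigzag_lt.
have z_inj : injective z.
  by move=> x y e; apply: val_inj; apply: zigzag_inj e.
exists (fun n => [set v : site K K | (z v.1 + z v.2) * K + v.2 < n]), (K.*2 * K).
apply: index_plan.
- move=> [x y] [x' y'] /= e.
  have ey : (y : nat) = y'.
    by have := congr1 (modn^~ K) e; rewrite !modnMDl !modn_small.
  have {}ey : y = y' by exact: val_inj.
  congr (_, _) => //; apply: z_inj; move: e; rewrite ey => /addIn/eqP.
  by rewrite eqn_mul2r eqn_add2r; case: (K) K0 => // k _ /eqP.
- case=> x y /=; have := zK x; have := zK y; have := ltn_ord y => *.
  by nia.
move=> n; set A := [set v | _].
pose s := n %/ K; pose i := n %% K.
have iK : i < K by rewrite ltn_mod.
have inA x y : ((x, y) \in A) = (z x < width K s i y).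
  rewrite inE /= {1}(divn_eq n K) -/s -/i /width leq_min zK /=.
  have yK := ltn_ord y; rewrite -/(z y).
  apply/idP/idP; case: (ltnP y i) => yi; nia.
apply: (@leq_trans (\sum_(y < K) overhang K s i y)); last by have := overhang_sum s K3 iK; lia.
have -> : #|frontier Periodic A| = \sum_(y < K) #|[pred x | (x, y) \in frontier Periodic A]|.
  rewrite -sum1_card big_mkcond /=.
  rewrite (eq_bigr (fun v => nat_of_bool ((v.1, v.2) \in frontier Periodic A))); last first.
    by case=> x y _; case: (_ \in _).
  rewrite -(pair_bigA _ (fun x y => nat_of_bool ((x, y) \in frontier Periodic A))) /=.
  rewrite exchange_big; apply: eq_bigr => y _.
  rewrite -sum1_card [RHS]big_mkcond; apply: eq_bigr => x _ /=.
  by rewrite -[x \in [pred _ | _]]/((x, y) \in frontier Periodic A); case: (_ \in _).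
apply: leq_sum => y _; rewrite /overhang.
apply: (card_window z_inj) => x.
rewrite -[x \in [pred _ | _]]/((x, y) \in frontier Periodic A).
case/frontierP; rewrite inA -leqNgt => -> [[x' y']]; rewrite inA => hx' adj.
have hx := ltn_ord x; have hy := ltn_ord y; have hy' := ltn_ord y'; have hx2 := ltn_ord x'.
have [[/= ey near_x]|[/= ex near_y]] := adjacent_near adj.
  rewrite ey in hx'; rewrite !leq_max orbC; apply/orP; left.
  have := cnear_zigzag hx2 hx near_x; rewrite -/(z x) -/(z x') => hz.
  by rewrite (leq_ltn_trans (leq0n _) hx') leq_min zK /=; lia.
rewrite ex in hx'; rewrite !leq_max; apply/orP; left.
by have [<-|<-] := cnear_cases hy hy' (cnear_sym near_y); rewrite hx' ?orbT.
Qed.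

(** The line swept across the lattice is parallel to its shorter side; only the
    square torus needs diamonds. *)
Lemma Gamma_plan bc K L : 1 < K -> 1 < L -> (bc = Periodic -> 6 <= K + L) ->
  exists (A : nat -> {set site K L}) N, sweep_plan bc (Gamma bc K L).-1 N A.
Proof.
move=> K1 L1 KL; have [e|ne] := eqVneq K L; last first.
  have [LK|KL'] := leqP L K.
    have := @row_plan bc K L; case: bc {KL} => [|] /=.
      by rewrite (negPf ne) (_ : minn (2 * K) (2 * L) = L.*2) //; lia.
    by rewrite (minn_idPr LK).
  have := @column_plan bc K L; case: bc {KL} => [|] /=.
    by rewrite (negPf ne) (_ : minn (2 * K) (2 * L) = K.*2) //; lia.
  by rewrite (minn_idPl (ltnW KL')).
rewrite -e in KL *; case: bc KL => [|_]; last first.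
  by have := @row_plan Open K K; rewrite /= minnn.
move=> /(_ erefl) KK; have := @square_plan K ltac:(lia).
by rewrite /= eqxx mul2n.
Qed.

Lemma Gamma_gt0 bc K L : 0 < K -> (Gamma bc K L).-1.+1 = Gamma bc K L.
Proof. by rewrite /Gamma; case: bc => //; case: ifP => //; lia. Qed.

Local Open Scope ring_scope.

Theorem theorem3p1 (bc : boundary) (K L M : nat)
    (hM : (2 <= M)%N) (hK : (2 <= K)%N) (hL : (2 <= L)%N)
    (hper : bc = Periodic -> (6 <= K + L)%N) :
  (forall s s' : config bc K L M,
     s \in stable bc K L M -> s' \in stable bc K L M -> s != s' ->
     comm_height s s' - energy s = (Gamma bc K L)%:Z) /\
  (forall sigma : config bc K L M,
     sigma \notin stable bc K L M ->
     comm_height_set [set sigma]%SET (stable bc K L M) - energy sigma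
       < (Gamma bc K L)%:Z).
Proof.
have M0 : (0 < M)%N by lia.
have GS := @Gamma_gt0 bc K L (ltnW hK).
have [A [N plan]] := Gamma_plan hK hL hper.
pose v0 := wrap_site (ltnW hK) (ltnW hL) 0 0.
split=> [s s' ss ss' ne|sigma _]; last first.
  by have := sweep_comm_height_stable sigma v0 M0 plan; lia.
apply/eqP; rewrite eq_le (comm_height_stable_ge hK hL hper M0 ss ss' ne) andbT.
rewrite stableE // in ss'; move/eqP: ss' => s'0.
have e := no_vacancy_mono s'0 v0.
have m0 : val s' v0 != ord0.
  by apply: contra_eqN s'0 => m0; rewrite -lt0n; apply/card_gt0P; exists v0; rewrite inE.
have := sweep_comm_height s plan m0; rewrite -e GS.
by lia.
Qed.
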